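(* Let $p\colon V\to M$ be a real vector bundle of rank $r$ over a $C^\infty$-manifold, endowed with a positive definite symmetric bilinear form $\langle\cdot,\cdot\rangle\colon V\oplus V=V\times_M V\to\mathbb{R}$, and let $\pi\colon OF(V)\to M$ be the principal $O(r)$-bundle of orthonormal frames of $V$. A diffeomorphism $\varphi\colon M\to M$ can be lifted to an isometry of the metric vector bundle $(V,\langle\cdot,\cdot\rangle)$ if and only if $\varphi$ can be lifted to an automorphism of the principal bundle $\pi\colon OF(V)\to M$. If, in addition, $V$ is an oriented vector bundle and $\pi\colon O^{+}F(V)\to M$ is the principal $SO(r)$-bundle of positively oriented orthonormal frames of $V$, then $\varphi$ can be lifted to an orientation-preserving isometry of $(V,\langle\cdot,\cdot\rangle)$ if and only if $\varphi$ can be lifted to an automorphism of the principal bundle $\pi\colon O^{+}F(V)\to M$.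
   Context: All manifolds are connected, second countable, $C^\infty$, without boundary and finite-dimensional (total spaces of frame bundles need not be connected); all maps, bundles and fibre metrics are $C^\infty$. An isometry of $(V,\langle\cdot,\cdot\rangle)$ lifting a diffeomorphism $\varphi$ of $M$ is a diffeomorphism $\Phi\colon V\to V$ mapping each fibre $V_x$ onto $V_{\varphi(x)}$ by a linear isometry $\Phi_x$; when $V$ is oriented it is orientation-preserving if every $\Phi_x\colon V_x\to V_{\varphi(x)}$ preserves the given orientations of the fibres. An automorphism of a principal $G$-bundle $\pi\colon P\to M$ is a $G$-equivariant diffeomorphism $\Psi\colon P\to P$; it is a lift of $\varphi$ if $\pi\circ\Psi=\varphi\circ\pi$. *)

(* Defs.v *)
From HB Require Import structures.
From mathcomp Require Import all_boot all_order all_algebra.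
From mathcomp Require Import all_classical all_reals all_analysis.
Set Implicit Arguments.
Unset Strict Implicit.
Unset Printing Implicit Defensive.
Import Order.TTheory GRing.Theory Num.Theory numFieldNormedType.Exports.
Local Open Scope classical_set_scope.
Local Open Scope ring_scope.

Section SmoothCalculus.
Context {R : realType}.

(* [Ck k f A] is meant for an open set A.  In finite dimension, f is of class
   C^(k+1) on A iff it is differentiable at every point of A and all its
   directional derivatives are of class C^k on A. *)
Fixpoint Ck {E F : normedModType R} (k : nat) (f : E -> F) (A : set E) : Prop :=
  match k with
  | 0 => forall x, A x -> {for x, continuous f}
  | k'.+1 => (forall x, A x -> differentiable f x) /\
             (forall v, Ck k' (fun x => 'D_v f x) A)
  end.

Definition Cinfty {E F : normedModType R} (f : E -> F) (A : set E) : Prop :=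
  forall k, Ck k f A.

End SmoothCalculus.

Section Charts.
Context {R : realType}.

(* A chart is given by its domain, the coordinate map and the inverse
   parametrization; the latter two are total functions, meaningful only on the
   domain and on its image respectively. *)
Record chart (T : topologicalType) (E : normedModType R) := Chart {
  chart_dom : set T;
  chart_map : T -> E;
  chart_inv : E -> T }.

Definition chart_img T E (c : chart T E) : set E := chart_map c @` chart_dom c.

Definition is_chart T E (c : chart T E) : Prop :=
  [/\ open (chart_dom c),
      open (chart_img c),
      forall x, chart_dom c x -> chart_inv c (chart_map c x) = x,
      forall x, chart_dom c x -> {for x, continuous (chart_map c)} &
      forall y, chart_img c y -> {for y, continuous (chart_inv c)}].

(* A topological space with a family of charts valued in the model space E. *)
Record charted (E : normedModType R) := Charted {
  charted_space :> topologicalType;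
  charts : set (chart charted_space E) }.

Arguments charts {E} X : rename.

Definition smooth_atlas E (X : charted E) : Prop :=
  [/\ forall c, charts X c -> is_chart c,
      forall x : X, exists2 c, charts X c & chart_dom c x &
      forall c d, charts X c -> charts X d ->
        Cinfty (chart_map d \o chart_inv c)
               (chart_map c @` (chart_dom c `&` chart_dom d))].

(* [U] is meant to be open, here and in [diffeo_on]. *)
Definition smooth_on E F (X : charted E) (Y : charted F) (U : set X)
    (f : X -> Y) : Prop :=
  (forall x, U x -> {for x, continuous f}) /\
  (forall c d, charts X c -> charts Y d ->
     Cinfty (chart_map d \o f \o chart_inv c)
            (chart_map c @` (chart_dom c `&` U `&` f @^-1` chart_dom d))).

Definition smooth E F (X : charted E) (Y : charted F) (f : X -> Y) : Prop :=
  smooth_on setT f.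

Definition diffeo_on E F (X : charted E) (Y : charted F)
    (U : set X) (W : set Y) (f : X -> Y) : Prop :=
  smooth_on U f /\ (forall x, U x -> W (f x)) /\
  exists g : Y -> X,
    [/\ smooth_on W g, forall y, W y -> U (g y),
        forall x, U x -> g (f x) = x & forall y, W y -> f (g y) = y].

Definition diffeo E F (X : charted E) (Y : charted F) (f : X -> Y) : Prop :=
  diffeo_on setT setT f.

Definition model_charted (E : normedModType R) : charted E :=
  @Charted E E [set @Chart E E setT id id].

Definition prod_chart T1 T2 E1 E2 (c : chart T1 E1) (d : chart T2 E2) :
    chart (T1 * T2)%type (E1 * E2)%type :=
  @Chart (T1 * T2)%type (E1 * E2)%type
    (chart_dom c `*` chart_dom d)
    (fun z => (chart_map c z.1, chart_map d z.2))
    (fun y => (chart_inv c y.1, chart_inv d y.2)).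

Definition prod_charted E1 E2 (X : charted E1) (Y : charted E2) :
    charted (E1 * E2)%type :=
  @Charted (E1 * E2)%type (X * Y)%type
    [set e | exists c d, [/\ charts X c, charts Y d & e = prod_chart c d]].

(* The k-fold power of a space modelled on 'rV_m is modelled on 'M_(k, m), the
   i-th row being the coordinates of the i-th component. *)
Definition pow_chart T k m (c : 'I_k -> chart T 'rV[R]_m) :
    chart (prod_topology (fun _ : 'I_k => T)) 'M[R]_(k, m) :=
  @Chart (prod_topology (fun _ : 'I_k => T)) 'M[R]_(k, m)
    [set f | forall i, chart_dom (c i) (f i)]
    (fun f => \matrix_(i, j) chart_map (c i) (f i) ord0 j)
    (fun y => fun i => chart_inv (c i) (row i y)).

Definition pow_charted k m (X : charted 'rV[R]_m) : charted 'M[R]_(k, m) :=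
  @Charted 'M[R]_(k, m) (prod_topology (fun _ : 'I_k => (X : topologicalType)))
    [set e | exists c, (forall i, charts X (c i)) /\ e = pow_chart c].

(* Smoothness of a map f : P -> Q between subsets i(P), j(Q) of charted spaces
   (embedded submanifolds below), in the usual sense for subsets: near each
   point f is the restriction of a smooth map defined on an open set of the
   ambient space. *)
Definition smooth_sub E F (X : charted E) (Y : charted F) (P Q : Type)
    (i : P -> X) (j : Q -> Y) (f : P -> Q) : Prop :=
  forall z : P, exists (W : set X) (g : X -> Y),
    [/\ open W, W (i z), smooth_on W g &
        forall z', W (i z') -> g (i z') = j (f z')].

End Charts.

Record smooth_manifold (R : realType) := SmoothManifold {
  mdim : nat;
  mcharted :> charted 'rV[R]_mdim;
  manifold_atlas : smooth_atlas mcharted;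
  manifold_hausdorff : hausdorff_space mcharted;
  manifold_second_countable : @second_countable mcharted;
  manifold_connected : connected [set: mcharted] }.

Section VectorBundles.
Context {R : realType} (M : smooth_manifold R) (r : nat).

(* For a total space with projection p, whose fibre over x is identified by
   inc with the vector space fib x: h is the second component of a local
   trivialization v |-> (p v, h v) from p^-1(U) onto U x R^r. *)
Definition is_trivialization (V : smooth_manifold R) (p : V -> M)
    (fib : M -> lmodType R) (inc : forall x, fib x -> V)
    (U : set M) (h : V -> 'rV[R]_r) : Prop :=
  [/\ open U,
      @diffeo_on R _ _ V (prod_charted M (model_charted 'rV[R]_r))
        (p @^-1` U) (U `*` setT) (fun v => (p v, h v)) &
      forall x, U x -> forall (a : R) (u v : fib x),
        h (inc x (a *: u + v)) = a *: h (inc x u) + h (inc x v)].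

Record vector_bundle := VectorBundle {
  vtotal :> smooth_manifold R;
  vproj : vtotal -> M;
  vproj_smooth : smooth vproj;
  vfib : M -> lmodType R;
  vinc : forall x, vfib x -> vtotal;
  vinc_inj : forall x, injective (@vinc x);
  vinc_fibre : forall x, range (@vinc x) = vproj @^-1` [set x];
  vtriv : forall x, exists U h,
    U x /\ is_trivialization vproj vinc U h }.

Definition local_trivialization (V : vector_bundle) (U : set M)
    (h : V -> 'rV[R]_r) : Prop :=
  is_trivialization (@vproj V) (@vinc V) U h.

(* Points of the Whitney sum V (+) V, a submanifold of V x V. *)
Definition whitney2 (V : vector_bundle) := {x : M & (vfib V x * vfib V x)%type}.

Definition whitney2_inc (V : vector_bundle) (z : whitney2 V) :
    prod_charted V V :=
  (vinc (projT2 z).1, vinc (projT2 z).2).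

Record bundle_metric (V : vector_bundle) := BundleMetric {
  ip : forall x, vfib V x -> vfib V x -> R;
  ip_sym : forall x (u v : vfib V x), ip u v = ip v u;
  ip_linear : forall x (w : vfib V x) (a : R) (u v : vfib V x),
    ip (a *: u + v) w = a * ip u w + ip v w;
  ip_pos : forall x (v : vfib V x), v != 0 -> 0 < ip v v;
  ip_smooth : @smooth_sub R _ _ (prod_charted V V) (model_charted R^o)
    (whitney2 V) R^o (@whitney2_inc V) id
    (fun z => ip (projT2 z).1 (projT2 z).2) }.

(* An orientation selects the positively oriented bases e of each fibre,
   continuously in the base point: near every point of M they are those with
   positive determinant with respect to some local trivialization.  For r = 0
   the only basis is the empty one, and it is positively oriented. *)
Record orientation (V : vector_bundle) := Orientation {
  opos : forall x, ('I_r -> vfib V x) -> Prop;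
  opos_local : forall x0, exists U h,
    [/\ U x0, @local_trivialization V U h &
        forall x, U x -> forall e : 'I_r -> vfib V x,
          opos e <-> 0 < \det (\matrix_(i, j) h (vinc (e i)) ord0 j)] }.

End VectorBundles.

Arguments orientation {R M r} V.
Arguments bundle_metric {R M r} V.

Section Lifts.
Context {R : realType} {M : smooth_manifold R} {r : nat}.
Context {V : vector_bundle M r}.

Definition isometry_lift (b : bundle_metric V) (phi : M -> M) (Phi : V -> V)
    (Phix : forall x, {linear vfib V x -> vfib V (phi x)}) : Prop :=
  [/\ diffeo Phi,
      forall x (v : vfib V x), Phi (vinc v) = vinc (Phix x v),
      forall x (w : vfib V (phi x)), exists v, Phix x v = w &
      forall x (u v : vfib V x), ip b (Phix x u) (Phix x v) = ip b u v].

Definition lifts_to_isometry (b : bundle_metric V) (phi : M -> M) : Prop :=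
  exists Phi Phix, @isometry_lift b phi Phi Phix.

Definition lifts_to_oriented_isometry (b : bundle_metric V)
    (o : orientation V) (phi : M -> M) : Prop :=
  exists Phi Phix, @isometry_lift b phi Phi Phix /\
    forall x (e : 'I_r -> vfib V x),
      opos o e -> opos o (fun i => Phix x (e i)).

(* P is the total space of a principal G-bundle over M with right action act,
   and its smooth structure is that of the embedded submanifold i(P) of X. *)
Definition lifts_to_automorphism (E : normedModType R) (X : charted E) (P G : Type) (i : P -> X)
    (proj : P -> M) (act : P -> G -> P) (phi : M -> M) : Prop :=
  exists Psi Psi' : P -> P,
    [/\ cancel Psi Psi' /\ cancel Psi' Psi,
        @smooth_sub R _ _ X X P P i i Psi /\ @smooth_sub R _ _ X X P P i i Psi',
        forall z a, Psi (act z a) = act (Psi z) a &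
        forall z, proj (Psi z) = phi (proj z)].

Lemma ip_suml (b : bundle_metric V) x (w : vfib V x) (c : 'I_r -> R)
    (e : 'I_r -> vfib V x) :
  ip b (\sum_k c k *: e k) w = \sum_k c k * ip b (e k) w.
Proof.
elim/big_rec2: _ => [|k y1 y2 _ <-]; last by rewrite ip_linear.
have := ip_linear b w 1 0 0.
by rewrite scale1r addr0 mul1r => /eqP; rewrite -subr_eq0 opprD addNKr oppr_eq0 => /eqP.
Qed.

Lemma ip_sumr (b : bundle_metric V) x (w : vfib V x) (c : 'I_r -> R)
    (e : 'I_r -> vfib V x) :
  ip b w (\sum_k c k *: e k) = \sum_k c k * ip b w (e k).
Proof.
by rewrite ip_sym ip_suml; apply: eq_bigr => k _; rewrite ip_sym.
Qed.

Definition orthogonal_group := {A : 'M[R]_r | A^T *m A = 1%:M}.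

Definition special_orthogonal_group :=
  {A : orthogonal_group | \det (sval A) = 1}.

Definition frame_act x (e : 'I_r -> vfib V x) (A : 'M[R]_r) : 'I_r -> vfib V x :=
  fun j => \sum_k A k j *: e k.

Definition orthonormal (b : bundle_metric V) x (e : 'I_r -> vfib V x) : Prop :=
  forall i j, ip b (e i) (e j) = (i == j)%:R.

Lemma orthonormal_act (b : bundle_metric V) x (e : 'I_r -> vfib V x)
    (A : orthogonal_group) :
  orthonormal b e -> orthonormal b (frame_act e (sval A)).
Proof.
move=> eo i j; case: A => A /= AA.
have -> : (i == j)%:R = (A^T *m A) i j by rewrite AA mxE.
rewrite /frame_act ip_suml mxE; apply: eq_bigr => k _.
rewrite ip_sumr mxE; congr (_ * _).
rewrite (bigD1 k) //= eo eqxx mulr1 big1 ?addr0 // => l /negPf lk.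
by rewrite eo eq_sym lk mulr0.
Qed.

Lemma opos_act (o : orientation V) x (e : 'I_r -> vfib V x) (A : 'M[R]_r) :
  \det A = 1 -> opos o e -> opos o (frame_act e A).
Proof.
move=> dA; have [U [h [Ux [_ _ hlin] oh]]] := opos_local o x.
rewrite !oh // => ep.
suff -> : \matrix_(i, j) h (vinc (frame_act e A i)) ord0 j =
    A^T *m \matrix_(i, j) h (vinc (e i)) ord0 j
  by rewrite det_mulmx det_tr dA mul1r.
apply/matrixP => i j; rewrite !mxE.
transitivity ((\sum_k A k i *: h (vinc (e k))) ord0 j); last first.
  by rewrite summxE; apply: eq_bigr => k _; rewrite !mxE.
congr (fun_of_matrix _ ord0 j); rewrite /frame_act.
elim/big_rec2: _ => [|k y1 y2 _ <-]; last exact: hlin.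
have := hlin x Ux 1 0 0.
by rewrite !scale1r addr0 => /eqP; rewrite -subr_eq0 opprD addNKr oppr_eq0 => /eqP.
Qed.

(* The orthonormal frame bundle OF(V), with its smooth structure of embedded
   submanifold of M x V^r: a local orthonormal frame (s_i) of V over U yields
   the local trivialization (x, A) |-> frame_act (s x) A of OF(V) over U.
   The factor M keeps track of the base point when r = 0. *)
Definition OF (b : bundle_metric V) :=
  {x : M & {e : 'I_r -> vfib V x | orthonormal b e}}.

Definition OF_proj b (z : OF b) : M := projT1 z.

Definition OF_frame b (z : OF b) : 'I_r -> vfib V (OF_proj z) :=
  sval (projT2 z).

Definition OF_inc b (z : OF b) : prod_charted M (pow_charted r V) :=
  (OF_proj z, fun i => vinc (OF_frame z i)).

Definition OF_act b (z : OF b) (A : orthogonal_group) : OF b :=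
  existT _ (OF_proj z)
    (exist _ (frame_act (OF_frame z) (sval A))
      (orthonormal_act A (svalP (projT2 z)))).

(* The bundle O^+F(V) of positively oriented orthonormal frames. *)
Definition OpF (b : bundle_metric V) (o : orientation V) :=
  {z : OF b | opos o (OF_frame z)}.

Definition OpF_proj b o (z : OpF b o) : M := OF_proj (sval z).

Definition OpF_inc b o (z : OpF b o) : prod_charted M (pow_charted r V) :=
  OF_inc (sval z).

Definition OpF_act b o (z : OpF b o) (A : special_orthogonal_group) : OpF b o :=
  exist (fun z : OF b => opos o (OF_frame z))
    (OF_act (sval z) (sval A)) (opos_act (svalP A) (svalP z)).

Definition lifts_to_OF_automorphism (b : bundle_metric V) (phi : M -> M) : Prop :=
  lifts_to_automorphism (@OF_inc b) (@OF_proj b) (@OF_act b) phi.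

Definition lifts_to_OpF_automorphism (b : bundle_metric V) (o : orientation V)
    (phi : M -> M) : Prop :=
  lifts_to_automorphism (@OpF_inc b o) (@OpF_proj b o) (@OpF_act b o) phi.

End Lifts.

(* Main.v *)
From HB Require Import structures.
Require Import Defs.
From mathcomp Require Import all_boot all_order all_algebra.
From mathcomp Require Import all_classical all_reals all_analysis.
From mathcomp Require Import ring.
Set Implicit Arguments.
Unset Strict Implicit.
Unset Printing Implicit Defensive.
Import Order.TTheory GRing.Theory Num.Theory numFieldNormedType.Exports.
Local Open Scope classical_set_scope.
Local Open Scope ring_scope.

(* An isometry [Phi] over [phi] maps orthonormal frames to orthonormal frames,
   and [(x, e) |-> (phi x, Phi \o e)] commutes with the action of O(r) because
   [Phi] is fibrewise linear; it is smooth as a restriction of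
   [phi \x Phi^r].  Conversely an automorphism [Psi] over [phi] defines
   [Phi v := \sum_i <v, e_i> Psi(e)_i] for any orthonormal frame [e] over the
   base point of [v]: by equivariance this does not depend on [e], it carries an
   orthonormal frame to an orthonormal frame, and its inverse is the map
   defined by the inverse of [Psi].  Choosing for [e] a smooth local orthonormal
   frame, which exists by Gram-Schmidt, shows that [Phi] is smooth.  In the
   oriented case the local frame can be made positive by flipping one vector,
   and the rest of the argument is the same. *)

(** The fibres of [V] are a family of types, and the frame of [Psi z] lives over [OF_proj (Psi z)],
    which agrees with [phi (OF_proj z)] only up to a proof. Vectors and frames are therefore
    compared in the total spaces, through [vinc] and [OF_inc], and smoothness is always stated for
    maps into [V]. The frame bundles carry no charts of their own. Smoothness of an automorphism is
    given as a local extension to the product of M and r copies of V; it becomes usable after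
    precomposition with a local frame, which turns the extension into a smooth map on M. The passage
    from automorphisms to isometries is carried out once for both bundles: it rests on transitivity
    of the structure group on the fibres and on the existence of local sections. *)

Arguments charts {R E} X : rename.

(** * Calculus of smooth maps between normed spaces *)

(** The first order expansion of [f] also holds for [g], and [diff_unique] identifies its linear
    part with the differential of [g]. *)
Lemma near_eq_differentiable (R : realType) (E F : normedModType R)
    (f g : E -> F) x :
  (\near x, f x = g x) -> differentiable f x -> differentiable g x.
Proof.
move=> fg df.
have [c e] := (diff_locallyP _ _).1 df.
have fgx : f x = g x := nbhs_singleton fg.
have e' : g \o shift x = cst (g x) + 'd f x +o_ 0 id.
  apply/eqaddoP => eps eps0.
  move/eqaddoP : e => /(_ _ eps0) e.
  have fg0 : \forall h \near 0, f (h + x) = g (h + x).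
    by rewrite (near_shift x); apply: filterS fg => h; rewrite /= sub0r subrK.
  apply: filterS2 e fg0 => h.
  by rewrite /= fgx => + hfg; rewrite !fctE /= hfg.
by apply/diff_locallyP; rewrite (diff_unique c e').
Qed.

Section Calculus.
Context {R : realType}.
Implicit Types E F G : normedModType R.

(** Each clause of [Ck] concerns one point of [A] at a time, and derivatives are taken in the whole
    space, so passing to [[set x]] loses nothing. *)
Lemma CkP E F k (f : E -> F) (A : set E) :
  Ck k f A <-> forall x, A x -> Ck k f [set x].
Proof.
split.
  elim: k f => [|k IH] f /=; first by move=> fA x Ax _ ->; exact: fA.
  by move=> [df cf] x Ax; split=> [_ ->|v]; [exact: df|exact: IH].
elim: k f => [|k IH] f /= fA; first by move=> x Ax; exact: (fA x Ax).
split=> [x Ax|v]; first by have [+ _] := fA x Ax; apply.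
by apply: IH => x Ax; have [_] := fA x Ax; apply.
Qed.

Lemma Ck_sub E F k (f : E -> F) (A B : set E) : B `<=` A -> Ck k f A -> Ck k f B.
Proof. by move=> BA /CkP fA; apply/CkP => x /BA; exact: fA. Qed.

(** On an open set the two maps agree near each point, hence so do their derivatives. The
    differentiation formulas below enter [Ck] through this lemma. *)
Lemma Ck_ext E F k (f g : E -> F) (A : set E) : open A ->
  (forall x, A x -> f x = g x) -> Ck k f A -> Ck k g A.
Proof.
move=> oA; elim: k f g => [|k IH] f g fg /=.
  move=> fA x Ax; have fgx : \near x, f x = g x.
    by apply: filterS (open_nbhs_nbhs (conj oA Ax)) => y /fg.
  rewrite /prop_for /continuous_at -(fg _ Ax); apply: cvg_trans (fA x Ax).
  exact: near_eq_cvg.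
have nfg x : A x -> \near x, f x = g x.
  by move=> Ax; apply: filterS (open_nbhs_nbhs (conj oA Ax)) => y /fg.
move=> [df cf]; split=> [x Ax|v].
  exact: near_eq_differentiable (nfg _ Ax) (df _ Ax).
by apply: IH (cf v) => x Ax; apply: near_eq_derive; exact: nfg.
Qed.

Lemma Ck_pred E F k (f : E -> F) (A : set E) : Ck k.+1 f A -> Ck k f A.
Proof.
elim: k f => [|k IH] f [df cf].
  by move=> x Ax; apply: differentiable_continuous; exact: df.
by split=> // v; exact: IH.
Qed.

(** Scalar multiplication is packed as a continuous bilinear map, whose differential is known, and
    composed with [y |-> (a y, f y)]. *)
Lemma differentiable_scale E F (a : E -> R) (f : E -> F) x :
  differentiable a x -> differentiable f x ->
  is_diff x (fun y => a y *: f y) (fun v => a x *: 'd f x v + 'd a x v *: f x).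
Proof.
move=> da df.
have lin : bilinear_for
    (GRing.Scale.Law.clone _ _ *:%R _) (GRing.Scale.Law.clone _ _ *:%R _)
    (fun (k : R) (v : F) => k *: v).
  split=> [u c v w|u c v w] /=; first by rewrite scalerDl scalerA.
  by rewrite scalerDr !scalerA mulrC.
pose bM := bilinear_isBilinear.Build R R F F _ _ _ lin.
pose bL : {bilinear R -> F -> F} := HB.pack (fun (k : R) (v : F) => k *: v) bM.
have bc : continuous (fun p : R * F => bL p.1 p.2).
  by move=> p; apply: scale_continuous.
have daf : is_diff x (fun y => (a y, f y)) (fun v => ('d a x v, 'd f x v)).
  by apply: is_diff_pair; exact: differentiableP.
have := @is_diff_comp _ _ _ _ (fun y => (a y, f y)) _
   (fun p : R * F => bL p.1 p.2) (fun q => bL (a x) q.2 + bL q.1 (f x)) x daf.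
apply.
apply: DiffDef; first exact: differentiable_bilin.
by rewrite (diff_bilin (a x, f x)).
Qed.

Lemma Ck_add E F k (f g : E -> F) (A : set E) : open A ->
  Ck k f A -> Ck k g A -> Ck k (fun x => f x + g x) A.
Proof.
move=> oA; elim: k f g => [|k IH] f g /=.
  by move=> fA gA x Ax; apply: cvgD; [exact: fA|exact: gA].
move=> [df cf] [dg cg]; split=> [x Ax|v].
  by apply: differentiableD; [exact: df|exact: dg].
apply: (Ck_ext oA) (IH _ _ (cf v) (cg v)) => x Ax.
by rewrite [RHS]deriveD //; apply: diff_derivable; [exact: df|exact: dg].
Qed.

Lemma Ck_cst E F k (c : F) (A : set E) : open A -> Ck k (fun=> c) A.
Proof.
move=> oA; elim: k c => [|k IH] c /=; first by move=> x _; exact: cvg_cst.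
split=> [x _|v]; first exact: differentiable_cst.
by apply: (Ck_ext oA) (IH 0) => x _; rewrite [RHS]derive_cst.
Qed.

Lemma Ck_sum E F k (I : Type) (r : seq I) (P : pred I) (f : I -> E -> F)
    (A : set E) : open A -> (forall i, Ck k (f i) A) ->
  Ck k (fun x => \sum_(i <- r | P i) f i x) A.
Proof.
move=> oA fA; elim: r => [|i r IH].
  by apply: (Ck_ext oA) (Ck_cst k 0 oA) => x _; rewrite big_nil.
apply: (Ck_ext oA _ (f := if P i then (fun x => f i x + \sum_(i <- r | P i) f i x)
   else fun x => \sum_(i <- r | P i) f i x)).
  by move=> x _; rewrite big_cons; case: ifP.
by case: ifP => // _; exact: Ck_add.
Qed.

Lemma Ck_scale E F k (a : E -> R) (f : E -> F) (A : set E) : open A ->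
  Ck k (a : E -> R^o) A -> Ck k f A -> Ck k (fun x => a x *: f x) A.
Proof.
move=> oA; elim: k a f => [|k IH] a f /=.
  by move=> aA fA x Ax; apply: cvgZ; [exact: aA|exact: fA].
move=> [da ca] [df cf]; split=> [x Ax|v].
  by have [] := differentiable_scale (da _ Ax) (df _ Ax).
(* In each Leibniz term one factor is not differentiated; the induction hypothesis needs it at order
   [k]. *)
have ca0 : Ck k (a : E -> R^o) A by apply: Ck_pred; split.
have cf0 : Ck k f A by apply: Ck_pred; split.
apply: (Ck_ext oA) (Ck_add oA (IH _ _ ca0 (cf v)) (IH _ _ (ca v) cf0)) => x Ax.
have [dd e] := differentiable_scale (da _ Ax) (df _ Ax).
rewrite [RHS]deriveE // e !deriveE //; [exact: da|exact: df].
Qed.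

(* The chain rule for higher derivatives is proved by expanding the outer
   differential in a basis of the middle space, hence its finite dimension. *)
Definition findim F := exists (I : finType) (e : I -> F) (c : I -> {linear F -> R^o}),
  (forall i, continuous (c i)) /\ forall y, y = \sum_i c i y *: e i.

Lemma Ck_lin E F G k (L : {linear F -> G}) (f : E -> F) (A : set E) : open A ->
  continuous L -> Ck k f A -> Ck k (L \o f) A.
Proof.
move=> oA cL; elim: k f => [|k IH] f /=.
  by move=> fA x Ax; apply: continuous_comp; [exact: fA|exact: cL].
move=> [df cf]; split=> [x Ax|v].
  exact: (differentiable_comp (df x Ax) (linear_differentiable _ cL)).
apply: (Ck_ext oA) (IH _ (cf v)) => x Ax.
have dL := linear_differentiable (f x) cL.
rewrite [RHS]deriveE; last exact: (differentiable_comp (df x Ax) dL).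
by rewrite (diff_comp (df x Ax) dL) /= diff_lin // deriveE //; exact: df.
Qed.

Lemma Ck_comp E F G k (f : E -> F) (g : F -> G) (A : set E) (B : set F) :
  findim F -> open A -> open B -> (forall x, A x -> B (f x)) ->
  Ck k f A -> Ck k g B -> Ck k (g \o f) A.
Proof.
move=> [I [e [c [cc ec]]]] oA oB AB; elim: k g => [|k IH] g.
  by move=> fA gB x Ax; apply: continuous_comp; [exact: fA|exact/gB/AB].
move=> cf [dg cg]; have [df cDf] := cf; split=> [x Ax|v].
  exact: (differentiable_comp (df x Ax) (dg _ (AB _ Ax))).
have cfk : Ck k f A by exact: Ck_pred.
(* The derivative of [g] is taken in the moving direction ['D_v f x], whereas [Ck] controls fixed
   directions only. Expanding that direction in the basis [e] leaves the fixed derivatives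
   ['D_(e i) g], composed with [f] by the induction hypothesis. *)
have H := Ck_sum _ _ oA (fun i : I => Ck_scale oA
  (Ck_lin oA (cc i) (cDf v)) (IH _ cfk (cg (e i)))).
apply: (Ck_ext oA (f := fun x => \sum_i c i ('D_v f x) *: 'D_(e i) g (f x)));
  last exact: H.
move=> x Ax; have dgx := dg _ (AB _ Ax).
rewrite [RHS]deriveE; last exact: (differentiable_comp (df x Ax) dgx).
rewrite (diff_comp (df x Ax) dgx) /= -(deriveE _ (df x Ax)).
rewrite [in RHS](ec ('D_v f x)) linear_sum; apply: eq_bigr => i _.
by rewrite linearZ /= (deriveE _ dgx).
Qed.

(** The neighbourhood is existential, so that closure properties carry no domains;
    [Cinfty_smooth_at] returns to a prescribed set. *)
Definition smooth_at E F (f : E -> F) (x : E) :=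
  exists A : set E, [/\ open A, A x & Cinfty f A].

Lemma smooth_at_ext E F (f g : E -> F) x :
  (\near x, f x = g x) -> smooth_at f x -> smooth_at g x.
Proof.
move=> fg [A [oA Ax fA]]; exists (A `&` (fun x => f x = g x)°); split.
- by apply: openI => //; exact: open_interior.
- by split.
- move=> k; apply: Ck_ext (Ck_sub _ (fA k)) => [|y [_]|y []//].
  + by apply: openI => //; exact: open_interior.
  + exact: interior_subset.
Qed.

Lemma smooth_at_continuous E F (f : E -> F) x : smooth_at f x ->
  {for x, continuous f}.
Proof. by move=> [A [_ Ax fA]]; exact: (fA 0%N). Qed.

Lemma Cinfty_smooth_at E F (f : E -> F) (A : set E) :
  (forall x, A x -> smooth_at f x) -> Cinfty f A.
Proof.
move=> fA k; apply/CkP => x Ax; have [B [oB Bx fB]] := fA x Ax.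
by apply: Ck_sub (fB k) => y ->.
Qed.

Lemma smooth_at_comp E F G (f : E -> F) (g : F -> G) x : findim F ->
  smooth_at f x -> smooth_at g (f x) -> smooth_at (g \o f) x.
Proof.
move=> fF sf; have cf := smooth_at_continuous sf.
move: sf => [A [oA Ax fA]] [B [oB Bx gB]].
(* [f] is known to be continuous only at points of [A], so openness is checked point by point. *)
have oAB : open (A `&` (f @^-1` B)).
  rewrite openE => y [Ay By]; apply: filterI.
    exact: (open_nbhs_nbhs (conj oA Ay)).
  by apply: (fA 0%N y Ay); exact: (open_nbhs_nbhs (conj oB By)).
exists (A `&` (f @^-1` B)); split => // k.
by apply: (Ck_comp fF oAB oB) (gB k) => [y []//|]; apply: Ck_sub (fA k) => y [].
Qed.

Lemma smooth_at_cst E F (c : F) x : smooth_at (fun _ : E => c) x.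
Proof.
by exists setT; split=> // [|k]; [exact: openT|apply: Ck_cst; exact: openT].
Qed.

Lemma smooth_at_id E (x : E) : smooth_at (fun x => x) x.
Proof.
exists setT; split=> //; first exact: openT.
case=> [y _|k]; first exact: cvg_id.
split=> [y _|v]; first by have [] := is_diff_id y.
apply: (Ck_ext openT) (Ck_cst k v openT) => y _.
by rewrite [RHS]derive_id.
Qed.

Lemma smooth_at_lin E F G (L : {linear F -> G}) (f : E -> F) x :
  continuous L -> smooth_at f x -> smooth_at (fun y => L (f y)) x.
Proof. by move=> cL [A [oA Ax fA]]; exists A; split=> // k; exact: Ck_lin. Qed.

Lemma smooth_at_add E F (f g : E -> F) x :
  smooth_at f x -> smooth_at g x -> smooth_at (fun y => f y + g y) x.
Proof.
move=> [A [oA Ax fA]] [B [oB Bx gB]].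
have oAB : open (A `&` B) by exact: openI.
exists (A `&` B); split => // k; apply: Ck_add => //.
- by apply: Ck_sub (fA k) => y [].
- by apply: Ck_sub (gB k) => y [].
Qed.

Lemma smooth_at_scale E F (a : E -> R^o) (f : E -> F) x :
  smooth_at a x -> smooth_at f x -> smooth_at (fun y => a y *: f y) x.
Proof.
move=> [A [oA Ax fA]] [B [oB Bx gB]].
have oAB : open (A `&` B) by exact: openI.
exists (A `&` B); split => // k; apply: Ck_scale => //.
- by apply: Ck_sub (fA k) => y [].
- by apply: Ck_sub (gB k) => y [].
Qed.

Lemma smooth_at_sum E F (I : Type) (r : seq I) (P : pred I) (f : I -> E -> F) x :
  (forall i, smooth_at (f i) x) ->
  smooth_at (fun y => \sum_(i <- r | P i) f i y) x.
Proof.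
move=> fx; elim: r => [|i r IH].
  by apply: smooth_at_ext (smooth_at_cst 0 x); near=> y; rewrite big_nil.
case Pi : (P i).
  by apply: smooth_at_ext (smooth_at_add (fx i) IH); near=> y; rewrite big_cons Pi.
by apply: smooth_at_ext IH; near=> y; rewrite big_cons Pi.
Unshelve. all: by end_near. Qed.

Lemma smooth_at_linear E F G (L : F -> G) (f : E -> F) x :
  linear L -> continuous L -> smooth_at f x -> smooth_at (fun y => L (f y)) x.
Proof.
move=> lin cL; pose LM := GRing.isLinear.Build _ _ _ _ _ lin.
pose LL : {linear F -> G} := HB.pack L LM.
exact: (@smooth_at_lin _ _ _ LL).
Qed.

Lemma smooth_at_pair E F G (f : E -> F) (g : E -> G) x :
  smooth_at f x -> smooth_at g x -> smooth_at (fun y => (f y, g y)) x.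
Proof.
move=> fx gx; apply: (smooth_at_ext (f := fun y => (f y, 0) + (0, g y))).
  by near=> y; rewrite -[LHS]/(f y + 0, 0 + g y) addr0 add0r.
apply: smooth_at_add.
  apply: (@smooth_at_linear _ _ _ (fun u : F => (u, 0 : G))) => //.
    by move=> a u v; congr (_, _); rewrite /= scaler0 addr0.
  by move=> u; apply: cvg_pair; [exact: cvg_id|exact: cvg_cst].
apply: (@smooth_at_linear _ _ _ (fun u : G => (0 : F, u))) => //.
  by move=> a u v; congr (_, _); rewrite /= scaler0 addr0.
by move=> u; apply: cvg_pair; [exact: cvg_cst|exact: cvg_id].
Unshelve. all: by end_near. Qed.

Lemma smooth_at_fst E F G (f : E -> F * G) x :
  smooth_at f x -> smooth_at (fun y => (f y).1) x.
Proof. by apply: (@smooth_at_linear _ _ _ fst) => // u; exact: cvg_fst. Qed.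

Lemma smooth_at_snd E F G (f : E -> F * G) x :
  smooth_at f x -> smooth_at (fun y => (f y).2) x.
Proof. by apply: (@smooth_at_linear _ _ _ snd) => // u; exact: cvg_snd. Qed.

Lemma smooth_at_coord E m n (f : E -> 'M[R]_(m, n)) x i j :
  smooth_at f x -> smooth_at (fun y => f y i j : R^o) x.
Proof.
apply: (@smooth_at_linear _ _ _ (fun A : 'M[R]_(m, n) => A i j : R^o)).
  by move=> a A B; rewrite !mxE.
exact: coord_continuous.
Qed.

Lemma smooth_at_mx E m n (f : E -> 'M[R]_(m, n)) x :
  (forall i j, smooth_at (fun y => f y i j : R^o) x) -> smooth_at f x.
Proof.
move=> fx; apply: (smooth_at_ext
  (f := fun y => \sum_i \sum_j f y i j *: delta_mx i j)).
  by near=> y; rewrite -matrix_sum_delta.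
apply: smooth_at_sum => i; apply: smooth_at_sum => j.
exact: (smooth_at_scale (fx i j) (smooth_at_cst _ _)).
Unshelve. all: by end_near. Qed.

Lemma findim_regular : findim R^o.
Proof.
exists unit, (fun=> 1 : R^o), (fun=> idfun); split=> [_ x|y]; first exact: cvg_id.
by rewrite (big_pred1 tt) => [|[]//]; rewrite /= /GRing.scale /= mulr1.
Qed.

Lemma linear_coord m n (i : 'I_m) (j : 'I_n) : linear (fun A : 'M[R]_(m, n) => A i j : R^o).
Proof. by move=> a A B; rewrite !mxE. Qed.

Lemma findim_mx m n : findim 'M[R]_(m, n).
Proof.
pose LM i j := GRing.isLinear.Build _ _ _ _ _ (@linear_coord m n i j).
pose L (p : 'I_m * 'I_n) : {linear 'M[R]_(m, n) -> R^o} :=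
  HB.pack (fun A : 'M[R]_(m, n) => A p.1 p.2 : R^o) (LM p.1 p.2).
exists ('I_m * 'I_n)%type, (fun p => delta_mx p.1 p.2), L; split=> [p|y].
  exact: coord_continuous.
by rewrite -(pair_big xpredT xpredT (fun i j => y i j *: delta_mx i j)) /=;
  exact: matrix_sum_delta.
Qed.

Lemma findim_prod E F : findim E -> findim F -> findim (E * F)%type.
Proof.
move=> [I [e [c [cc ec]]]] [J [e' [c' [cc' ec']]]].
have lin (k : I + J) : linear (fun p : E * F =>
    match k with inl i => c i p.1 | inr j => c' j p.2 end : R^o).
  by case: k => k a p q /=; rewrite linearP.
pose LM k := GRing.isLinear.Build _ _ _ _ _ (lin k).
pose L k : {linear (E * F)%type -> R^o} := HB.pack (fun p : E * F =>
    match k with inl i => c i p.1 | inr j => c' j p.2 end : R^o) (LM k).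
exists (I + J)%type, (fun k => match k with inl i => (e i, 0) | inr j => (0, e' j) end), L.
split=> [[i|j] p|[x y]].
- by apply: (continuous_comp (f := fst)); [exact: cvg_fst|exact: cc].
- by apply: (continuous_comp (f := snd)); [exact: cvg_snd|exact: cc'].
rewrite big_sumType /= {1}[x]ec {1}[y]ec'.
set S := (X in _ = X + _); set S' := (X in _ = _ + X).
suff -> : S = (\sum_i c i x *: e i, 0).
  suff -> : S' = (0, \sum_i c' i y *: e' i).
    by congr (_, _); rewrite /= ?addr0 ?add0r.
  rewrite /S'; elim/big_rec2: _ => // j u v _ ->.
  by congr (_, _); rewrite /= scaler0 addr0.
rewrite /S; elim/big_rec2: _ => // j u v _ ->.
by congr (_, _); rewrite /= scaler0 addr0.
Qed.

Lemma derive_regular (f : R^o -> R^o) (v t d : R) :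
  is_derive (t : R^o) (1 : R^o) f d -> 'D_v f t = v * d.
Proof.
move=> [df <-]; have {}df : differentiable f t by exact/derivable1_diffP.
rewrite !deriveE // -[v in LHS]mulr1 -[v * 1]/(v *: (1 : R^o)).
by rewrite linearZ.
Qed.

(** The derivative is written as a polynomial in the function itself, which closes the induction on
    the order in [smooth_at_rsqrt]. *)
Lemma is_derive_rsqrt (t : R) : 0 < t -> is_derive (t : R^o) (1 : R^o)
  (fun t : R^o => (Num.sqrt t)^-1 : R^o) (- 2^-1 * ((Num.sqrt t)^-1) ^+ 3).
Proof.
move=> t0; have [ds es] := is_derive1_sqrt t0.
have s0 : Num.sqrt t != 0 by rewrite gt_eqF // sqrtr_gt0.
have dv := derivableV s0 ds.
split=> //; rewrite [LHS](deriveV s0 ds) es.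
rewrite /GRing.scale /=; field.
by rewrite s0.
Qed.

Lemma smooth_at_rsqrt E (f : E -> R^o) x : 0 < f x ->
  smooth_at f x -> smooth_at (fun y => (Num.sqrt (f y))^-1 : R^o) x.
Proof.
move=> fx0 fx; apply: (smooth_at_comp (g := fun t : R^o => (Num.sqrt t)^-1 : R^o)) => //.
  exact: findim_regular.
have oA : open [set t : R^o | 0 < t] by exact: open_gt.
exists [set t | 0 < t]; split=> //; elim=> [|k IH].
  move=> t t0; apply: differentiable_continuous.
  by apply/derivable1_diffP; have [] := is_derive_rsqrt t0.
split=> [t t0|v].
  by apply/derivable1_diffP; have [] := is_derive_rsqrt t0.
apply: (Ck_ext oA (f := fun t : R^o => ((- v / 2) : R^o) *: ((Num.sqrt t)^-1 *:
   ((Num.sqrt t)^-1 *: ((Num.sqrt t)^-1 : R^o))))).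
  move=> t t0; rewrite (derive_regular v (is_derive_rsqrt t0)).
  by rewrite /GRing.scale /= !exprS expr0 mulr1 !mulNr mulrN -!mulrA.
by do !(apply: Ck_scale => //); exact: Ck_cst.
Qed.

End Calculus.

(** * Smoothness at a point of a manifold *)

Section ContinuityNear.
Implicit Types X Y Z : topologicalType.

Lemma near_eq_continuous X Y (f g : X -> Y) x : (\near x, f x = g x) ->
  {for x, continuous f} -> {for x, continuous g}.
Proof.
move=> fg cf; rewrite /prop_for /continuous_at -(nbhs_singleton fg).
by apply: cvg_trans cf; exact: near_eq_cvg.
Qed.

Definition continuous_near X Y (f : X -> Y) (x : X) :=
  \forall y \near x, {for y, continuous f}.

Lemma continuous_near_at X Y (f : X -> Y) x :
  continuous_near f x -> {for x, continuous f}.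
Proof. exact: nbhs_singleton. Qed.

Lemma continuous_near_ext X Y (f g : X -> Y) x : (\near x, f x = g x) ->
  continuous_near f x -> continuous_near g x.
Proof.
move=> /near_join; rewrite /continuous_near => fg; apply: filterS2 fg => y.
exact: near_eq_continuous.
Qed.

Lemma continuous_near_comp X Y Z (f : X -> Y) (g : Y -> Z) x :
  continuous_near f x -> continuous_near g (f x) -> continuous_near (g \o f) x.
Proof.
move=> cf cg; have := continuous_near_at cf cg.
by apply: filterS2 cf => y cfy cgy; exact: continuous_comp.
Qed.

Lemma continuous_pow X Y k (f : X -> 'I_k -> Y) x :
  (forall i, {for x, continuous (f ^~ i)}) ->
  {for x, continuous (f : X -> prod_topology (fun=> Y))}.
Proof.
move=> cf; apply/cvg_sup => i U [V] [[W] oW <-] Wfx WU.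
apply: filterS WU _; apply: cf; exact: (open_nbhs_nbhs (conj oW Wfx)).
Qed.

Lemma pow_proj_continuous Y k (i : 'I_k) :
  continuous (fun f : prod_topology (fun _ : 'I_k => Y) => f i).
Proof. exact: proj_continuous. Qed.

Lemma open_setX X Y (A : set X) (B : set Y) : open A -> open B -> open (A `*` B).
Proof.
move=> oA oB; rewrite openE => -[x y] [/= Ax By].
by exists (A, B) => //; split; exact: open_nbhs_nbhs.
Qed.

End ContinuityNear.

Section Manifolds.
Context {R : realType}.
Implicit Types E F G : normedModType R.

(** This half of [smooth_atlas] carries the composition lemmas, because [msmooth] quantifies over
    all pairs of charts, and it passes to products factor by factor. Compatibility of charts enters
    through [msmooth_id]. *)
Definition charted_ok E (X : charted E) : Prop :=
  (forall c, charts X c -> is_chart c) /\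
  (forall x : X, exists2 c, charts X c & chart_dom c x).

Lemma smooth_atlas_ok E (X : charted E) : smooth_atlas X -> charted_ok X.
Proof. by case. Qed.

Lemma chart_nbhs E (X : charted E) (c : chart X E) (x : X) : is_chart c -> chart_dom c x ->
  \near x, chart_dom c x.
Proof. by move=> [oc _ _ _ _] cx; exact: (open_nbhs_nbhs (conj oc cx)). Qed.

Lemma chart_inv_near E (X : charted E) (c : chart X E) (x : X) (U : set X) :
  is_chart c -> chart_dom c x -> nbhs x U ->
  \forall y \near chart_map c x, U (chart_inv c y).
Proof.
move=> [oc oi cK _ ci] cx xU.
have cy : chart_img c (chart_map c x) by exists x.
by apply: (ci _ cy); rewrite cK.
Qed.

Lemma chart_map_near E (X : charted E) (c : chart X E) (x : X) : is_chart c -> chart_dom c x ->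
  \forall y \near chart_map c x,
    chart_dom c (chart_inv c y) /\ chart_map c (chart_inv c y) = y.
Proof.
move=> [oc oi cK _ ci] cx.
have cy : chart_img c (chart_map c x) by exists x.
apply: filterS (open_nbhs_nbhs (conj oi cy)) => _ [z cz <-].
by rewrite cK.
Qed.

Lemma chart_image_open E (X : charted E) (c : chart X E) (U : set X) : is_chart c ->
  (forall x, chart_dom c x -> U x -> nbhs x U) ->
  open (chart_map c @` (chart_dom c `&` U)).
Proof.
move=> cc oU; rewrite openE => _ [x [cx Ux] <-].
have xU := oU _ cx Ux.
apply: filterS2 (chart_inv_near cc cx xU) (chart_map_near cc cx) => y Uy [dy e].
by exists (chart_inv c y).
Qed.

(* Continuity near [x] does not follow from smoothness in charts: a chart map
   is arbitrary outside its domain. *)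
Definition msmooth E F (X : charted E) (Y : charted F) (f : X -> Y) (x : X) : Prop :=
  continuous_near f x /\
  forall c d, charts X c -> charts Y d -> chart_dom c x -> chart_dom d (f x) ->
    smooth_at (chart_map d \o f \o chart_inv c) (chart_map c x).

(** The bridge between smoothness on an open set and the pointwise notion, in which all
    constructions below are carried out. *)
Lemma smooth_onP E F (X : charted E) (Y : charted F) (U : set X) (f : X -> Y) :
  charted_ok X -> charted_ok Y -> open U ->
  smooth_on U f <-> forall x, U x -> msmooth f x.
Proof.
move=> [Xc _] [Yc _] oU; split.
  move=> [cf sf] x Ux; have xU := open_nbhs_nbhs (conj oU Ux).
  split; first by apply: filterS xU => y /cf.
  move=> c d Xc' Yd cx dx.
  have cc := Xc _ Xc'; have cd := Yc _ Yd.
  exists (chart_map c @` (chart_dom c `&` U `&` f @^-1` chart_dom d)); split.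
  - rewrite -setIA; apply: chart_image_open => // y cy [Uy dy]; apply: filterI.
      exact: (open_nbhs_nbhs (conj oU Uy)).
    by apply: (cf _ Uy); exact: chart_nbhs.
  - by exists x.
  - exact: sf.
move=> sf; split=> [x /sf[/continuous_near_at]//|c d Xc' Yd].
apply: Cinfty_smooth_at => _ [x [[cx Ux] dx] <-].
by apply: (sf x Ux).2.
Qed.

Lemma msmooth_continuous E F (X : charted E) (Y : charted F) (f : X -> Y) x :
  msmooth f x -> {for x, continuous f}.
Proof. by case=> /continuous_near_at. Qed.

Lemma msmooth_ext E F (X : charted E) (Y : charted F) (f g : X -> Y) x :
  charted_ok X -> (\near x, f x = g x) -> msmooth f x -> msmooth g x.
Proof.
move=> [Xc _] fg [cf sf]; split; first exact: continuous_near_ext cf.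
move=> c d Xc' Yd cx dx; have cc := Xc _ Xc'.
apply: smooth_at_ext (sf _ _ Xc' Yd cx _); last by rewrite (nbhs_singleton fg).
by apply: filterS (chart_inv_near cc cx fg) => y /= ->.
Qed.

Lemma msmooth_comp E F G (X : charted E) (Y : charted F) (Z : charted G)
    (f : X -> Y) (g : Y -> Z) x : charted_ok X -> charted_ok Y -> findim F ->
  msmooth f x -> msmooth g (f x) -> msmooth (g \o f) x.
Proof.
move=> [Xc _] [Yc Yx] fF [cf sf] [cg sg]; split.
  exact: continuous_near_comp.
move=> c e Xc' Ze cx ex; have [d Yd dx] := Yx (f x).
have cc := Xc _ Xc'; have cd := Yc _ Yd.
have dK : chart_inv d (chart_map d (f x)) = f x by case: cd => _ _ + _ _; apply.
have cK : chart_inv c (chart_map c x) = x by case: cc => _ _ + _ _; apply.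
have := smooth_at_comp fF (sf c d Xc' Yd cx dx).
move/(_ _ (chart_map e \o g \o chart_inv d)); rewrite /= cK.
move=> /(_ (sg d e Yd Ze dx ex)); apply: smooth_at_ext.
(* Continuity keeps [f] inside the intermediate chart [d] near [x], so that [chart_inv d] and
   [chart_map d] cancel there. *)
have ndf : \near x, chart_dom d (f x).
  by apply: (continuous_near_at cf); exact: chart_nbhs.
apply: filterS (chart_inv_near cc cx ndf) => y dy /=.
by case: cd => _ _ -> .
Qed.

Lemma smoothP E F (X : charted E) (Y : charted F) (f : X -> Y) :
  charted_ok X -> charted_ok Y -> smooth f <-> forall x, msmooth f x.
Proof.
move=> okX okY; rewrite /smooth (smooth_onP f okX okY openT).
by split=> [fs x|fs x _]; exact: fs.
Qed.

Lemma msmooth_id E (X : charted E) (x : X) : smooth_atlas X ->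
  msmooth (fun y : X => y) x.
Proof.
move=> [Xc _ Xs]; split; first by near=> y; exact: cvg_id.
move=> c d Xc' Xd cx dx; have cc := Xc _ Xc'; have cd := Xc _ Xd.
exists (chart_map c @` (chart_dom c `&` chart_dom d)); split.
- by apply: chart_image_open => // y cy dy; exact: chart_nbhs.
- by exists x.
- exact: Xs.
Unshelve. all: by end_near. Qed.

Lemma msmooth_cst E F (X : charted E) (Y : charted F) (c : Y) (x : X) :
  msmooth (fun=> c) x.
Proof.
split; first by near=> y; exact: cvg_cst.
by move=> *; exact: smooth_at_cst.
Unshelve. all: by end_near. Qed.

Lemma model_ok E : charted_ok (model_charted E).
Proof.
split=> [c ->|x]; last by exists (Chart setT id id).
split=> //=; first exact: openT.
- by rewrite /chart_img /= image_id; exact: openT.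
- by move=> x _; exact: cvg_id.
- by move=> x _; exact: cvg_id.
Qed.

Lemma model_atlas E : smooth_atlas (model_charted E).
Proof.
have [Xc Xx] := model_ok E; split=> // c d -> ->.
by apply: Cinfty_smooth_at => x _; exact: smooth_at_id.
Qed.

(** The target has one global chart, the identity, so here continuity does follow: near [x] the map
    is its chart expression composed with a chart map. *)
Lemma msmooth_modelP E F (X : charted E) (f : X -> model_charted F) x :
  charted_ok X -> msmooth f x <->
  forall c, charts X c -> chart_dom c x ->
    smooth_at (f \o chart_inv c : E -> F) (chart_map c x).
Proof.
move=> [Xc Xx]; split=> [[_ sf] c Xc' cx|sf].
  exact: (sf c (Chart setT id id) Xc' erefl cx I).
split; last by move=> c _ Xc' -> cx _; exact: sf.
have [c Xc' cx] := Xx x; have cc := Xc _ Xc'.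
have [A [oA Ax fA]] := sf c Xc' cx.
have cm : {for x, continuous (chart_map c)} by case: cc => _ _ _ + _; apply.
have nA : \near x, A (chart_map c x).
  by apply: cm; exact: (open_nbhs_nbhs (conj oA Ax)).
have nd := chart_nbhs cc cx.
apply: (continuous_near_ext (f := (f \o chart_inv c) \o chart_map c)).
  by apply: filterS nd => y cy; case: cc => _ _ /= -> .
apply: filterS2 nA nd => y Ay cy; apply: continuous_comp; last exact: (fA 0%N).
by case: cc => _ _ _ + _; apply.
Qed.

Lemma msmooth_model E F (f : E -> F) x :
  smooth_at f x -> @msmooth _ _ (model_charted E) (model_charted F) f x.
Proof.
by move=> fx; apply/msmooth_modelP; [exact: model_ok|move=> c ->].
Qed.

Section IntoModel.
Context E (X : charted E) (okX : charted_ok X).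
Implicit Types x : X.

Lemma msmooth_model_comp F G (f : X -> F) (g : F -> G) x : findim F ->
  @msmooth _ _ X (model_charted F) f x -> smooth_at g (f x) ->
  @msmooth _ _ X (model_charted G) (g \o f) x.
Proof.
move=> fF fx gx; apply: msmooth_comp fx _ => //; first exact: model_ok.
exact: msmooth_model.
Qed.

Lemma msmooth_scale F (a : X -> R) (f : X -> F) x :
  @msmooth _ _ X (model_charted R^o) a x -> @msmooth _ _ X (model_charted F) f x ->
  @msmooth _ _ X (model_charted F) (fun y => a y *: f y) x.
Proof.
move=> /(msmooth_modelP _ _ okX) ax /(msmooth_modelP _ _ okX) fx.
apply/(msmooth_modelP _ _ okX) => c Xc cx.
exact: smooth_at_scale (ax c Xc cx) (fx c Xc cx).
Qed.

Lemma msmooth_sum F (I : Type) (r : seq I) (P : pred I) (f : I -> X -> F) x :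
  (forall i, @msmooth _ _ X (model_charted F) (f i) x) ->
  @msmooth _ _ X (model_charted F) (fun y => \sum_(i <- r | P i) f i y) x.
Proof.
move=> fx; apply/(msmooth_modelP _ _ okX) => c Xc cx.
apply: (@smooth_at_sum _ _ _ _ r P (fun i => f i \o chart_inv c)) => i.
by apply: (msmooth_modelP _ _ okX).1.
Qed.

End IntoModel.

Lemma prod_chart_ok E F (X : charted E) (Y : charted F) (c : chart X E)
    (d : chart Y F) : is_chart c -> is_chart d -> is_chart (prod_chart c d).
Proof.
move=> cc cd; have [oc oic cK ccm cci] := cc; have [od oid dK dcm dci] := cd.
have img : chart_img (prod_chart c d) = chart_img c `*` chart_img d.
  apply/seteqP; split=> [_ [[x y] [/= cx dy] <-]|[u w] [[x cx /= xu] [y dy /= yw]]].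
    by split; [exists x|exists y].
  by exists (x, y) => //=; rewrite xu yw.
split.
- exact: open_setX.
- by rewrite img; exact: open_setX.
- by move=> [x y] [/= cx dy]; rewrite /prod_chart /= cK // dK.
- move=> [x y] [/= cx dy]; apply: cvg_pair.
    by apply: (continuous_comp (f := fst)); [exact: cvg_fst|exact: ccm].
  by apply: (continuous_comp (f := snd)); [exact: cvg_snd|exact: dcm].
- rewrite img => -[x y] [/= cx dy]; apply: cvg_pair.
    by apply: (continuous_comp (f := fst)); [exact: cvg_fst|exact: cci].
  by apply: (continuous_comp (f := snd)); [exact: cvg_snd|exact: dci].
Qed.

Lemma prod_ok E F (X : charted E) (Y : charted F) :
  charted_ok X -> charted_ok Y -> charted_ok (prod_charted X Y).
Proof.
move=> [Xc Xx] [Yc Yx]; split=> [_ [c [d [Xc' Yd ->]]]|[x y]].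
  by apply: prod_chart_ok; [exact: Xc|exact: Yc].
have [c Xc' cx] := Xx x; have [d Yd dy] := Yx y.
by exists (prod_chart c d) => //; exists c, d.
Qed.

Lemma msmooth_pair E F G (X : charted E) (Y : charted F) (Z : charted G)
    (f : X -> Y) (g : X -> Z) x : msmooth f x -> msmooth g x ->
  @msmooth _ _ X (prod_charted Y Z) (fun y => (f y, g y)) x.
Proof.
move=> [cf sf] [cg sg]; split.
  by apply: filterS2 cf cg => y cfy cgy; exact: cvg_pair.
move=> c _ Xc [d [e [Yd Ze ->]]] cx [/= dx ex].
by apply: smooth_at_pair; [exact: sf|exact: sg].
Qed.

Lemma msmooth_fst E F (X : charted E) (Y : charted F) (z : X * Y) :
  smooth_atlas X -> findim E ->
  @msmooth _ _ (prod_charted X Y) X (fun z => z.1) z.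
Proof.
move=> aX fE; split; first by near=> y; exact: cvg_fst.
move=> _ d [c [e [Xc Ye ->]]] Xd [/= cx ey] dx.
have [_ sid] := msmooth_id z.1 aX.
apply: (smooth_at_comp (f := fst) (g := chart_map d \o chart_inv c)) => //.
- exact/smooth_at_fst/smooth_at_id.
- exact: sid.
Unshelve. all: by end_near. Qed.

Lemma msmooth_snd E F (X : charted E) (Y : charted F) (z : X * Y) :
  smooth_atlas Y -> findim F ->
  @msmooth _ _ (prod_charted X Y) Y (fun z => z.2) z.
Proof.
move=> aX fE; split; first by near=> y; exact: cvg_snd.
move=> _ d [e [c [Xe Yc ->]]] Xd [/= ex cx] dx.
have [_ sid] := msmooth_id z.2 aX.
apply: (smooth_at_comp (f := snd) (g := chart_map d \o chart_inv c)) => //.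
- exact/smooth_at_snd/smooth_at_id.
- exact: sid.
Unshelve. all: by end_near. Qed.

Lemma row_continuous m n (i : 'I_m) : continuous (fun A : 'M[R]_(m, n) => row i A).
Proof.
move=> A; apply: smooth_at_continuous; apply: smooth_at_mx => j l.
apply: (smooth_at_ext (f := fun B : 'M[R]_(m, n) => B i l : R^o)).
  by near=> B; rewrite mxE.
exact/smooth_at_coord/smooth_at_id.
Unshelve. all: by end_near. Qed.

Lemma mx_continuous (T : topologicalType) m n (f : T -> 'M[R]_(m, n)) x :
  (forall i j, {for x, continuous (fun y => f y i j)}) -> {for x, continuous f}.
Proof.
move=> cf U [P nP PU]; apply: (filterS (P := fun y => forall i j, P i j (f y i j))).
  by move=> y Py; exact: PU.
apply: filter_forall => i; apply: filter_forall => j; exact: cf.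
Qed.

Lemma pow_chart_ok m k (X : charted 'rV[R]_m) (c : 'I_k -> chart X 'rV[R]_m) :
  (forall i, is_chart (c i)) -> is_chart (pow_chart c).
Proof.
move=> cc.
have img : chart_img (pow_chart c) =
    [set y | forall i, chart_img (c i) (row i y)].
  apply/seteqP; split=> [_ [f cf <-] i|y cy].
    by exists (f i) => //; apply/rowP => j; rewrite !mxE.
  have /choice[f fP] : forall i, exists x, chart_dom (c i) x /\ chart_map (c i) x = row i y.
    by move=> i; have [x] := cy i; exists x.
  exists f; first by move=> i; case: (fP i).
  by apply/matrixP => i j; rewrite mxE; have [_ ->] := fP i; rewrite mxE.
split.
- rewrite openE => f cf.
  apply: (@filter_forall _ _ (fun i g => chart_dom (c i) (g i)) (nbhs f)) => i.
  exact: (@pow_proj_continuous X k i f _ (chart_nbhs (cc i) (cf i))).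
- rewrite img openE => y cy.
  apply: (@filter_forall _ _ (fun i y => chart_img (c i) (row i y)) (nbhs y)) => i.
  have [_ oi _ _ _] := cc i.
  exact: (@row_continuous k m i y _ (open_nbhs_nbhs (conj oi (cy i)))).
- move=> f cf; apply/funext => i /=; have [_ _ cK _ _] := cc i.
  rewrite -[RHS]cK //; congr (chart_inv _ _); apply/rowP => j.
  by rewrite !mxE.
- move=> f cf; apply: mx_continuous => i j.
  have [_ _ _ cm _] := cc i.
  suff : {for f, continuous ((fun A : 'rV_m => A ord0 j) \o
      (chart_map (c i) \o (fun g : prod_topology (fun _ : 'I_k => X) => g i)))}.
    by apply: near_eq_continuous; near=> g; rewrite /= mxE.
  apply: continuous_comp; last exact: coord_continuous.
  apply: continuous_comp; first exact: pow_proj_continuous.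
  exact: cm.
- rewrite img => y cy; apply: continuous_pow => i.
  apply: (continuous_comp (f := row i)); first exact: row_continuous.
  by have [_ _ _ _ ci] := cc i; exact: ci.
Unshelve. all: by end_near. Qed.

Lemma pow_ok m k (X : charted 'rV[R]_m) : charted_ok X ->
  charted_ok (pow_charted k X).
Proof.
move=> [Xc Xx]; split=> [_ [c [cc ->]]|f].
  by apply: pow_chart_ok => i; exact: Xc.
have /choice[c cP] : forall i, exists c, charts X c /\ chart_dom c (f i).
  by move=> i; have [c] := Xx (f i); exists c.
exists (pow_chart c); first by exists c; split=> // i; case: (cP i).
by move=> i; case: (cP i).
Qed.

Lemma msmooth_tuple E m k (X : charted E) (Y : charted 'rV[R]_m)
    (f : X -> 'I_k -> Y) x : (forall i, msmooth (f ^~ i) x) ->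
  @msmooth _ _ X (pow_charted k Y) f x.
Proof.
move=> sf; split.
  have : \forall y \near x, forall i, {for y, continuous (f ^~ i)}.
    by apply: filter_forall => i; case: (sf i).
  by apply: filterS => y; exact: continuous_pow.
move=> c _ Xc [d [Yd ->]] cx dx; apply: smooth_at_mx => i j.
have [_ /(_ c (d i) Xc (Yd i) cx (dx i))] := sf i.
move/(@smooth_at_coord _ _ _ _ _ _ ord0 j); apply: smooth_at_ext.
by near=> y; rewrite mxE.
Unshelve. all: by end_near. Qed.

Lemma msmooth_proj m k (X : charted 'rV[R]_m) (i : 'I_k) f :
  smooth_atlas X -> @msmooth _ _ (pow_charted k X) X (fun f => f i) f.
Proof.
move=> aX; split; first by near=> y; exact: pow_proj_continuous.
move=> _ d [c [Xc ->]] Xd cx dx.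
have [_ sid] := msmooth_id (f i) aX.
have e : row i (chart_map (pow_chart c) f) = chart_map (c i) (f i).
  by apply/rowP => j; rewrite !mxE.
apply: (smooth_at_comp (f := row i) (g := chart_map d \o chart_inv (c i))).
- exact: findim_mx.
- apply: smooth_at_mx => a j; apply: (smooth_at_ext (f := fun A : 'M[R]_(k, m) => A i j : R^o)).
    by near=> y; rewrite mxE.
  exact/smooth_at_coord/smooth_at_id.
- by rewrite e; apply: sid => //; exact: cx.
Unshelve. all: by end_near. Qed.

(** Compatibility of two power charts is smoothness of the identity, seen as the tuple of its
    coordinate projections. *)
Lemma pow_atlas m k (X : charted 'rV[R]_m) : smooth_atlas X ->
  smooth_atlas (pow_charted k X).
Proof.
move=> aX; have [Xc Xx] := pow_ok k (smooth_atlas_ok aX); split=> // c d Xc' Xd.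
apply: Cinfty_smooth_at => _ [f [cf df] <-].
have [_ sid] : @msmooth _ _ (pow_charted k X) (pow_charted k X) (fun f => f) f.
  by apply: msmooth_tuple => i; exact: msmooth_proj.
exact: sid.
Qed.

End Manifolds.

(** * Local orthonormal frames *)

Section Bundles.
Context {R : realType} {M : smooth_manifold R} {r : nat}.
Context {V : vector_bundle M r}.

Lemma manifold_ok (N : smooth_manifold R) : charted_ok N.
Proof. exact/smooth_atlas_ok/manifold_atlas. Qed.

(* Reads a point [v] of the total space as a vector of the fibre over [x]
   without transport along an equality [vproj v = x] (junk value [0] when [v]
   does not lie over [x]). *)
Definition fibre_pt (x : M) (v : V) : vfib V x := xget 0 [set u | vinc u = v].

Lemma vincK x (u : vfib V x) : fibre_pt x (vinc u) = u.
Proof.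
apply: vinc_inj.
by apply: (@xgetPex _ 0 [set w : vfib V x | vinc w = vinc u]); exists u.
Qed.

Lemma vproj_vinc x (u : vfib V x) : vproj (vinc u) = x.
Proof. by have /seteqP[+ _] := @vinc_fibre _ _ _ V x; apply; exists u. Qed.

Lemma fibre_ptK x (v : V) : vproj v = x -> vinc (fibre_pt x v) = v.
Proof.
move=> vx; have /seteqP[_ /(_ v vx)[u _ <-]] := @vinc_fibre _ _ _ V x.
by rewrite vincK.
Qed.

Lemma vproj_msmooth (v : V) : msmooth (@vproj _ _ _ V) v.
Proof.
exact: ((smoothP _ (manifold_ok V) (manifold_ok M)).1 (vproj_smooth V)).
Qed.

Lemma findim_prod_rV m n : findim ('rV[R]_m * 'rV[R]_n)%type.
Proof. by apply: findim_prod; exact: findim_mx. Qed.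

Lemma trivialization_inv U h : @local_trivialization _ _ _ V U h ->
  exists g : prod_charted M (model_charted 'rV[R]_r) -> V,
  [/\ forall x c, U x -> vproj (g (x, c)) = x /\ h (g (x, c)) = c,
      forall v : V, U (vproj v) -> g (vproj v, h v) = v &
      forall x c, U x -> msmooth g (x, c)].
Proof.
move=> [oU [_ [_ [g [sg Wg gf fg]]]] _]; exists g; split.
- by move=> x c Ux; have [e1 e2] := fg (x, c) (conj Ux I).
- by move=> v Uv; exact: gf.
- move=> x c Ux.
  have okp : charted_ok (prod_charted M (model_charted 'rV[R]_r)).
    by apply: prod_ok; [exact: manifold_ok|exact: model_ok].
  apply: (smooth_onP g okp (manifold_ok V) _).1 sg (x, c) (conj Ux I).
  exact: open_setX oU openT.
Qed.

Lemma trivialization_msmooth U h (v : V) : @local_trivialization _ _ _ V U h ->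
  U (vproj v) -> @msmooth _ _ _ V (model_charted 'rV[R]_r) h v.
Proof.
move=> [oU [sf _] _] Uv.
have okp : charted_ok (prod_charted M (model_charted 'rV[R]_r)).
  by apply: prod_ok; [exact: manifold_ok|exact: model_ok].
have opU : open (@vproj _ _ _ V @^-1` U).
  rewrite openE => w Uw; apply: (msmooth_continuous (vproj_msmooth w)).
  exact: (open_nbhs_nbhs (conj oU Uw)).
have sv := (smooth_onP _ (manifold_ok V) okp opU).1 sf v Uv.
exact: (msmooth_comp (manifold_ok V) okp (findim_prod_rV _ _) sv
  (msmooth_snd _ (model_atlas _) (findim_mx _ _))).
Qed.

Lemma trivialization_sum U h x (I : Type) (s : seq I) (P : pred I)
    (c : I -> R) (u : I -> vfib V x) : @local_trivialization _ _ _ V U h -> U x ->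
  h (vinc (\sum_(i <- s | P i) c i *: u i)) =
  \sum_(i <- s | P i) c i *: h (vinc (u i)).
Proof.
move=> [_ _ hlin] Ux.
elim/big_rec2: _ => [|i y1 y2 _ <-]; last exact: hlin.
(* The empty sum: linearity at [1 *: 0 + 0] reads [h 0 = h 0 + h 0]. *)
have := hlin x Ux 1 0 0.
by rewrite !scale1r addr0 => /eqP; rewrite -subr_eq0 opprD addNKr oppr_eq0 => /eqP.
Qed.

Lemma trivialization_inj U h x (u v : vfib V x) :
  @local_trivialization _ _ _ V U h -> U x -> h (vinc u) = h (vinc v) -> u = v.
Proof.
move=> hU Ux huv; have [g [_ gK _]] := trivialization_inv hU.
apply: vinc_inj; rewrite -(gK (vinc u)) ?vproj_vinc // huv.
by rewrite -[in RHS](gK (vinc v)) ?vproj_vinc.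
Qed.

Section Combinations.
Context (E : normedModType R) (X : charted E) (okX : charted_ok X).

Lemma msmooth_near (N : smooth_manifold R) (q : X -> N) (x : X) (U : set N) :
  msmooth q x -> open U -> U (q x) -> \forall y \near x, U (q y).
Proof.
by move=> sq oU Uq; apply: (msmooth_continuous sq); exact: (open_nbhs_nbhs (conj oU Uq)).
Qed.

(** The sum is formed in a fibre that varies with [y]. In a trivialization around [q x] it becomes a
    sum in one fixed space of row vectors, and the inverse trivialization [g] carries it back. The
    [w i y] need to lie over [q y] only near [x]; elsewhere [fibre_pt] may return its default. *)
Lemma msmooth_comb (I : finType) (q : X -> M) (a : I -> X -> R) (w : I -> X -> V) x :
  msmooth q x -> (forall i, @msmooth _ _ _ X (model_charted R^o) (a i) x) ->
  (forall i, msmooth (w i) x) -> (\forall y \near x, forall i, vproj (w i y) = q y) ->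
  msmooth (fun y => vinc (\sum_i a i y *: fibre_pt (q y) (w i y))) x.
Proof.
move=> sq sa sw pw; have [U [h [Uq hU]]] := vtriv V (q x).
have oU : open U by case: hU.
have [g [gp gK gs]] := trivialization_inv hU.
apply: (msmooth_ext (f := fun y => g (q y, \sum_i a i y *: h (w i y)))) => //.
  apply: filterS2 (msmooth_near sq oU Uq) pw => y Uy py.
  rewrite -[RHS]gK ?vproj_vinc // (trivialization_sum _ _ _ _ hU) //.
  by congr (g (_, _)); apply: eq_bigr => i _; rewrite fibre_ptK.
apply: (msmooth_comp okX _ (findim_prod_rV _ _) _ (gs _ _ Uq)).
  by apply: prod_ok; [exact: manifold_ok|exact: model_ok].
apply: msmooth_pair => //; apply: msmooth_sum => // i.
apply: msmooth_scale => //.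
apply: (msmooth_comp okX (manifold_ok V) (findim_mx _ _) (sw i)).
by apply: (trivialization_msmooth hU); rewrite (nbhs_singleton pw).
Qed.

(** The metric is smooth only as a restriction to the Whitney sum. Its local extension [g] to V x V
    is composed with the pair [(s, t)], which lands in the Whitney sum near [x]. *)
Lemma msmooth_ip (b : bundle_metric V) (q : X -> M) (s t : X -> V) x :
  msmooth s x -> msmooth t x ->
  (\forall y \near x, vproj (s y) = q y) -> (\forall y \near x, vproj (t y) = q y) ->
  @msmooth _ _ _ X (model_charted R^o)
    (fun y => ip b (fibre_pt (q y) (s y)) (fibre_pt (q y) (t y))) x.
Proof.
move=> ss st ps pt.
pose z y : whitney2 V := existT _ (q y) (fibre_pt (q y) (s y), fibre_pt (q y) (t y)).
have zE : \forall y \near x, whitney2_inc (z y) = (s y, t y).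
  by apply: filterS2 ps pt => y py py'; rewrite /whitney2_inc /= !fibre_ptK.
have [W [g [oW Wz sg gE]]] := ip_smooth b (z x).
have sst := msmooth_pair ss st.
have Wst : W (s x, t x) by rewrite -(nbhs_singleton zE).
have okVV : charted_ok (prod_charted V V) by apply: prod_ok; exact: manifold_ok.
apply: (msmooth_ext (f := fun y => g (s y, t y))) => //.
  have nW : \forall y \near x, W (s y, t y).
    by apply: (msmooth_continuous sst); exact: (open_nbhs_nbhs (conj oW Wst)).
  apply: filterS2 nW zE => y Wy zy.
  by rewrite -[LHS]/(g (s y, t y)) -zy gE //= zy.
apply: (msmooth_comp okX okVV (findim_prod_rV _ _) sst).
exact: (smooth_onP g okVV (model_ok _) oW).1.
Qed.

End Combinations.

Lemma section_comb (I : finType) (a : I -> M -> R) (t : I -> forall x, vfib V x) x :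
  (forall i, @msmooth _ _ _ M (model_charted R^o) (a i) x) ->
  (forall i, msmooth (fun y => vinc (t i y)) x) ->
  msmooth (fun y => vinc (\sum_i a i y *: t i y)) x.
Proof.
move=> sa st.
have pt : \forall y \near x, forall i, vproj (vinc (t i y)) = y.
  by near=> y => i; rewrite vproj_vinc.
have := msmooth_comb (manifold_ok M) (msmooth_id x (manifold_atlas M)) sa st pt.
apply: msmooth_ext; first exact: manifold_ok.
by near=> y; congr (vinc _); apply: eq_bigr => i _; rewrite vincK.
Unshelve. all: by end_near. Qed.

Lemma section_ip b (s t : forall x, vfib V x) (x : M) :
  msmooth (fun y => vinc (s y)) x -> msmooth (fun y => vinc (t y)) x ->
  @msmooth _ _ _ M (model_charted R^o) (fun y => ip b (s y) (t y)) x.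
Proof.
move=> ss st.
have := @msmooth_ip _ M (manifold_ok M) b id _ _ x ss st.
rewrite /=; under [X in _ -> _ -> @msmooth _ _ _ _ _ X _]eq_fun do rewrite !vincK.
by apply; near=> y; rewrite vproj_vinc.
Unshelve. all: by end_near. Qed.

Lemma ipBl b x (u v w : vfib V x) : ip b (u - v) w = ip b u w - ip b v w.
Proof. by rewrite addrC -scaleN1r ip_linear mulN1r addrC. Qed.

Lemma ipZl b x (a : R) (u w : vfib V x) : ip b (a *: u) w = a * ip b u w.
Proof.
have ip0 : ip b 0 w = 0.
  have := ip_linear b w 1 0 0.
  by rewrite scale1r addr0 mul1r => /eqP; rewrite -subr_eq0 opprD addNKr oppr_eq0 => /eqP.
by rewrite -[a *: u]addr0 ip_linear ip0 addr0.
Qed.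

Lemma ip_suml_gen b x (w : vfib V x) (I : finType) (c : I -> R) (e : I -> vfib V x) :
  ip b (\sum_i c i *: e i) w = \sum_i c i * ip b (e i) w.
Proof.
elim/big_rec2: _ => [|i y1 y2 _ <-]; last by rewrite ip_linear.
by rewrite -(scale0r 0) ipZl mul0r.
Qed.

(** Otherwise the identity matrix of size [r] would factor through dimension [k], against
    [k < r]. *)
Lemma partial_frame_incomplete U h x k (t : nat -> vfib V x)
    (s : 'I_r -> vfib V x) : @local_trivialization _ _ _ V U h -> U x -> (k < r)%N ->
  (forall j, h (vinc (s j)) = delta_mx 0 j) ->
  exists j, forall c : 'I_k -> R, s j <> \sum_(i < k) c i *: t i.
Proof.
move=> hU Ux kr hs; apply: contrapT => /forallNP H.
have /choice[c cP] : forall j, exists c : 'I_k -> R, s j = \sum_(i < k) c i *: t i.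
  by move=> j; have /existsNP[c /contrapT] := H j; exists c.
pose C := \matrix_(j < r, i < k) c j i.
pose T := \matrix_(i < k) h (vinc (t i)).
have CT : C *m T = 1%:M.
  apply/row_matrixP => j; rewrite row1 -hs cP (trivialization_sum _ _ _ _ hU) //.
  rewrite row_mul; apply/rowP => l; rewrite !mxE summxE; apply: eq_bigr => i _.
  by rewrite !mxE.
have := mxrankM_maxr C T; rewrite CT mxrank1 leqNgt.
by rewrite (leq_ltn_trans (rank_leq_row T) kr).
Qed.

(* Gram-Schmidt, one vector at a time: at most [k < r] orthonormal sections
   cannot span the fibre over [x0], so some section of a trivialization has a
   component orthogonal to them which is nonzero over [x0], hence near [x0]. *)
Lemma partial_orthonormal_frame b (x0 : M) k : (k <= r)%N ->
  exists t : nat -> forall x, vfib V x,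
  (forall i, (i < k)%N -> msmooth (fun x => vinc (t i x)) x0) /\
  \forall x \near x0, forall i j, (i < k)%N -> (j < k)%N ->
    ip b (t i x) (t j x) = (i == j)%:R.
Proof.
elim: k => [|k IH] kr; first by exists (fun _ _ => 0); split=> //; near=> x.
have [t [st ot]] := IH (ltnW kr).
have [U [h [Ux hU]]] := vtriv V x0.
have oU : open U by case: hU.
have [g [gp gK gs]] := trivialization_inv hU.
pose s (j : 'I_r) x : vfib V x := fibre_pt x (g (x, delta_mx 0 j)).
have gsj j : msmooth (fun x => g (x, delta_mx 0 j)) x0.
  have okp : charted_ok (prod_charted M (model_charted 'rV[R]_r)).
    by apply: prod_ok; [exact: manifold_ok|exact: model_ok].
  apply: (msmooth_comp (manifold_ok M) okp (findim_prod_rV _ _) _ (gs _ _ Ux)).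
  apply: (@msmooth_pair _ _ _ _ M M (model_charted 'rV[R]_r)).
    exact/msmooth_id/manifold_atlas.
  exact: msmooth_cst.
have ss j : msmooth (fun x => vinc (s j x)) x0.
  apply: msmooth_ext (gsj j); first exact: manifold_ok.
  apply: filterS (open_nbhs_nbhs (conj oU Ux)) => x Ux'.
  by rewrite fibre_ptK //; case: (gp x (delta_mx 0 j) Ux').
have [j jP] : exists j, forall c : 'I_k -> R, s j x0 <> \sum_(i < k) c i *: t i x0.
  apply: (@partial_frame_incomplete U h x0 k (t ^~ x0) (s ^~ x0)) => // j.
  by have [p1 p2] := gp x0 (delta_mx 0 j) Ux; rewrite fibre_ptK.
pose u x : vfib V x := s j x - \sum_(i < k) ip b (s j x) (t i x) *: t i x.
have su : msmooth (fun x => vinc (u x)) x0.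
  (* The sum type packs [s j] and its projections into a single linear combination, the form
     required by [section_comb]. *)
  pose a (o : unit + 'I_k) (x : M) : R :=
    if o is inr i then - ip b (s j x) (t i x) else 1.
  pose w (o : unit + 'I_k) (x : M) : vfib V x :=
    if o is inr i then t i x else s j x.
  have sa o : @msmooth _ _ _ M (model_charted R^o) (a o) x0.
    case: o => [[]|i]; first exact: msmooth_cst.
    apply: (@msmooth_ext _ _ _ M (model_charted R^o)
      (fun x => (-1 : R^o) *: (ip b (s j x) (t i x) : R^o))).
    - exact: manifold_ok.
    - by near=> x; rewrite scaleN1r.
    - apply: msmooth_scale; [exact: manifold_ok|exact: msmooth_cst|].
      by apply: section_ip => //; exact: st.
  have sw o : msmooth (fun x => vinc (w o x)) x0.
    by case: o => [[]|i]; [exact: ss|exact: st].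
  apply: msmooth_ext (section_comb sa sw); first exact: manifold_ok.
  near=> x; congr (vinc _); rewrite big_sumType /= (big_pred1 tt) => [|[]//].
  rewrite scale1r /u; congr (_ + _).
  by rewrite -sumrN; apply: eq_bigr => i _; rewrite scaleNr.
have u0 : u x0 != 0.
  apply/eqP => /eqP; rewrite subr_eq0 => /eqP; exact: jP.
have suu : @msmooth _ _ _ M (model_charted R^o) (fun x => ip b (u x) (u x)) x0.
  exact: section_ip.
have uu0 : 0 < ip b (u x0) (u x0) by exact: ip_pos.
have uup : \forall x \near x0, 0 < ip b (u x) (u x).
  have oP : open [set y : R^o | 0 < y] by exact: open_gt.
  exact: (msmooth_continuous suu (open_nbhs_nbhs (conj oP uu0))).
pose n x := (Num.sqrt (ip b (u x) (u x)))^-1.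
have sn : @msmooth _ _ _ M (model_charted R^o) n x0.
  apply: (msmooth_model_comp (manifold_ok M) (g := fun y : R^o => (Num.sqrt y)^-1 : R^o)
    findim_regular suu).
  by apply: smooth_at_rsqrt => //; exact: smooth_at_id.
(* Index [k] receives the normalized new vector. Larger indices receive it too, but the claim stops
   below [k.+1]. *)
exists (fun i x => if (i < k)%N then t i x else n x *: u x); split.
  move=> i _; case ik: (i < k)%N; first exact: st.
  have := @section_comb unit (fun _ => n) (fun _ => u) x0 (fun=> sn) (fun=> su).
  apply: msmooth_ext; first exact: manifold_ok.
  by near=> x; congr (vinc _); rewrite (big_pred1 tt) => [|[]].
have ut : \forall x \near x0, forall i, (i < k)%N -> ip b (u x) (t i x) = 0.
  apply: filterS ot => x otx i ik; rewrite /u ipBl ip_suml_gen.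
  rewrite (bigD1 (Ordinal ik)) //= otx // eqxx mulr1 big1 ?addr0 ?subrr // => l.
  by rewrite -val_eqE /= => /negPf li; rewrite otx // li mulr0.
apply: filterS3 ot uup ut => x otx up utx i l; rewrite !ltnS => ik lk.
case: ltnP => ik'; case: ltnP => lk'.
- exact: otx.
- rewrite ip_sym ipZl utx // mulr0.
  by case: eqP => // il; move: ik'; rewrite il ltnNge lk'.
- rewrite ipZl utx // mulr0.
  by case: eqP => // il; move: lk'; rewrite -il ltnNge ik'.
- rewrite ipZl ip_sym ipZl mulrA -invfM -expr2 sqr_sqrtr ?ltW // mulVf; last by rewrite gt_eqF.
  have -> : i = k by apply/eqP; rewrite eqn_leq ik.
  have -> : l = k by apply/eqP; rewrite eqn_leq lk.
  by rewrite eqxx.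
Unshelve. all: by end_near. Qed.

Lemma local_orthonormal_frame b (x0 : M) :
  exists t : 'I_r -> forall x, vfib V x,
  (forall i, msmooth (fun x => vinc (t i x)) x0) /\
  \forall x \near x0, Defs.orthonormal b (t ^~ x).
Proof.
have [t [st ot]] := partial_orthonormal_frame b x0 (leqnn r).
exists (fun i => t i); split=> [i|]; first exact: st.
by apply: filterS ot => x otx i j; rewrite otx.
Qed.

End Bundles.

Lemma continuous_det (R : realType) (T : topologicalType) n
    (f : T -> 'M[R]_n) (x : T) :
  (forall i j, {for x, continuous (fun y => f y i j : R^o)}) ->
  {for x, continuous (fun y => \det (f y) : R^o)}.
Proof.
move=> cf; have cprod (I : Type) (s : seq I) (g : I -> T -> R^o) :
    (forall i, {for x, continuous (g i)}) ->
    {for x, continuous (fun y => \prod_(i <- s) g i y : R^o)}.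
  move=> cg; elim: s => [|i s IH].
    apply: (near_eq_continuous (f := fun=> 1 : R^o)); last exact: cvg_cst.
    by near=> y; rewrite big_nil.
  apply: (near_eq_continuous (f := fun y => g i y * \prod_(j <- s) g j y : R^o)).
    by near=> y; rewrite big_cons.
  by apply: cvgM; [exact: cg|exact: IH].
have csum (I : Type) (s : seq I) (g : I -> T -> R^o) :
    (forall i, {for x, continuous (g i)}) ->
    {for x, continuous (fun y => \sum_(i <- s) g i y : R^o)}.
  move=> cg; elim: s => [|i s IH].
    apply: (near_eq_continuous (f := fun=> 0 : R^o)); last exact: cvg_cst.
    by near=> y; rewrite big_nil.
  apply: (near_eq_continuous (f := fun y => g i y + \sum_(j <- s) g j y : R^o)).
    by near=> y; rewrite big_cons.
  by apply: cvgD; [exact: cg|exact: IH].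
by apply: csum => s; apply: cvgM; [exact: cvg_cst|exact: cprod].
Unshelve. all: by end_near. Qed.

(** * Coordinate matrices of frames, transition matrices and orientations *)

Section Frames.
Context {R : realType} {M : smooth_manifold R} {r : nat}.
Context {V : vector_bundle M r}.

Definition frame_mx (h : V -> 'rV[R]_r) x (e : 'I_r -> vfib V x) : 'M[R]_r :=
  \matrix_(i, j) h (vinc (e i)) ord0 j.

Lemma frame_mx_comb U h x (e : 'I_r -> vfib V x) (c : 'rV[R]_r) :
  @local_trivialization _ _ _ V U h -> U x ->
  h (vinc (\sum_i c ord0 i *: e i)) = c *m frame_mx h e.
Proof.
move=> hU Ux; rewrite (trivialization_sum _ _ _ _ hU) // mulmx_sum_row.
by apply: eq_bigr => i _; congr (_ *: _); apply/rowP => j; rewrite !mxE.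
Qed.

(** Frame vectors are the rows of [frame_mx], so the right action turns into left multiplication by
    the transpose. *)
Lemma frame_mx_act U h x (e : 'I_r -> vfib V x) (A : 'M[R]_r) :
  @local_trivialization _ _ _ V U h -> U x ->
  frame_mx h (frame_act e A) = A^T *m frame_mx h e.
Proof.
move=> hU Ux; apply/row_matrixP => i; rewrite row_mul -(frame_mx_comb _ _ hU) //.
have -> : row i (frame_mx h (frame_act e A)) = h (vinc (frame_act e A i)).
  by apply/rowP => j; rewrite !mxE.
by congr (h (vinc _)); apply: eq_bigr => k _; rewrite !mxE.
Qed.

Lemma orthonormal_coord b x (e : 'I_r -> vfib V x) (c : 'I_r -> R) j :
  Defs.orthonormal b e -> ip b (\sum_i c i *: e i) (e j) = c j.
Proof.
move=> oe; rewrite ip_suml (bigD1 j) //= oe eqxx mulr1 big1 ?addr0 // => i ij.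
by rewrite oe (negPf ij) mulr0.
Qed.

(** A row [c] killed by the matrix is a linear relation among the [e i]; pairing it with [e j] shows
    that its [j]-th coefficient vanishes. *)
Lemma orthonormal_frame_mx_unit b U h x (e : 'I_r -> vfib V x) :
  @local_trivialization _ _ _ V U h -> U x -> Defs.orthonormal b e ->
  frame_mx h e \in unitmx.
Proof.
move=> hU Ux oe; rewrite -row_free_unit; apply: inj_row_free => c c0.
have e0 : \sum_i c ord0 i *: e i = \sum_i 0 *: e i.
  apply: (trivialization_inj hU Ux); rewrite (frame_mx_comb _ _ hU) // c0.
  rewrite (trivialization_sum _ _ _ _ hU) // big1 // => i _.
  by rewrite scale0r.
apply/rowP => j; rewrite mxE -(orthonormal_coord (fun i => c ord0 i) j oe) e0.
exact: (orthonormal_coord (fun=> 0)).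
Qed.

(** A fibre is an abstract module without a stated dimension. That [e] spans it is read off a
    trivialization, where its coordinate matrix is invertible. *)
Lemma orthonormal_span b x (e : 'I_r -> vfib V x) (v : vfib V x) :
  Defs.orthonormal b e -> v = \sum_i ip b v (e i) *: e i.
Proof.
move=> oe; have [U [h [Ux hU]]] := vtriv V x.
have eU := orthonormal_frame_mx_unit hU Ux oe.
pose c := h (vinc v) *m invmx (frame_mx h e).
have vE : v = \sum_i c ord0 i *: e i.
  apply: (trivialization_inj hU Ux); rewrite (frame_mx_comb _ _ hU) //.
  by rewrite /c mulmxKV.
rewrite [LHS]vE; apply: eq_bigr => i _; congr (_ *: _).
by rewrite vE (orthonormal_coord (fun i => c ord0 i)).
Qed.

Definition transition b x (e e' : 'I_r -> vfib V x) : 'M[R]_r :=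
  \matrix_(k, j) ip b (e' j) (e k).

Lemma transitionP b x (e e' : 'I_r -> vfib V x) : Defs.orthonormal b e ->
  e' = frame_act e (transition b e e').
Proof.
move=> oe; apply/funext => j; rewrite [LHS](orthonormal_span _ oe).
by apply: eq_bigr => k _; rewrite mxE.
Qed.

Lemma transition_orthogonal b x (e e' : 'I_r -> vfib V x) :
  Defs.orthonormal b e -> Defs.orthonormal b e' ->
  (transition b e e')^T *m transition b e e' = 1%:M.
Proof.
move=> oe oe'; apply/matrixP => i j; rewrite !mxE -(oe' i j).
rewrite [X in ip b X _](orthonormal_span (e' i) oe) ip_suml.
by apply: eq_bigr => k _; rewrite !mxE (ip_sym b (e k)).
Qed.

Lemma opos_actP (o : orientation V) x (e : 'I_r -> vfib V x) (A : 'M[R]_r) :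
  opos o e -> opos o (frame_act e A) <-> 0 < \det A.
Proof.
have [U [h [Ux hU oh]]] := opos_local o x.
rewrite !oh // -/(frame_mx h e) -/(frame_mx h (frame_act e A)) => ep.
by rewrite (frame_mx_act _ _ hU) // det_mulmx det_tr pmulr_lgt0.
Qed.

Lemma local_oriented_orthonormal_frame b (o : orientation V) (x0 : M) :
  exists t : 'I_r -> forall x, vfib V x,
  (forall i, msmooth (fun x => vinc (t i x)) x0) /\
  \forall x \near x0, Defs.orthonormal b (t ^~ x) /\ opos o (t ^~ x).
Proof.
have [t [st ot]] := local_orthonormal_frame b x0.
have [U [h [Ux hU oh]]] := opos_local o x0.
have oU : open U by case: hU.
have nU := open_nbhs_nbhs (conj oU Ux).
have cd : {for x0, continuous (fun x => \det (frame_mx h (t ^~ x)) : R^o)}.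
  apply: continuous_det => i j.
  have sh : @msmooth _ _ _ M (model_charted 'rV[R]_r) (fun x => h (vinc (t i x))) x0.
    apply: (msmooth_comp (manifold_ok M) (manifold_ok V) (findim_mx _ _) (st i)).
    by apply: (trivialization_msmooth hU); rewrite vproj_vinc.
  apply: (near_eq_continuous (f := (fun A : 'rV[R]_r => A ord0 j : R^o) \o
      (fun x => h (vinc (t i x))))).
    by near=> x; rewrite mxE.
  apply: continuous_comp; first exact: (msmooth_continuous sh).
  exact: coord_continuous.
have d0 : \det (frame_mx h (t ^~ x0)) != 0.
  rewrite -unitfE -unitmxE.
  exact: (orthonormal_frame_mx_unit hU Ux (nbhs_singleton ot)).
have [dp|dn] := ltP 0 (\det (frame_mx h (t ^~ x0))).
  have oP : open [set y : R^o | 0 < y] by exact: open_gt.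
  exists t; split=> //.
  apply: filterS3 ot nU (cd _ (open_nbhs_nbhs (conj oP dp))) => x otx Ux' dx.
  by split=> //; apply/oh.
have {d0}dn : \det (frame_mx h (t ^~ x0)) < 0 by rewrite lt_neqAle d0.
(* An empty determinant equals 1, so a negative one guarantees that there is a vector to flip. *)
have r0 : (0 < r)%N.
  rewrite lt0n; apply/eqP => r0.
  have det1 (A : 'M[R]_r) : \det A = 1.
    by move: A; rewrite r0 => A; exact: det_mx00.
  by move: dn; rewrite det1 ltr10.
pose i0 := Ordinal r0.
(* Flipping the vector [i0] is the action of a constant orthogonal matrix of determinant -1, so
   smoothness and orthonormality persist while the sign changes. *)
pose D : 'M[R]_r := diag_mx (\row_j (-1) ^+ (j == i0)).
have DD : D^T *m D = 1%:M.
  rewrite tr_diag_mx mulmx_diag -diag_const_mx; congr diag_mx.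
  by apply/rowP => j; rewrite !mxE -expr2 sqrr_sign.
have dD : \det D = -1.
  rewrite det_diag (bigD1 i0) //= mxE eqxx expr1 big1 ?mulr1 // => j /negPf ji.
  by rewrite mxE ji expr0.
have oN : open [set y : R^o | y < 0] by exact: open_lt.
exists (fun i x => frame_act (t ^~ x) D i); split.
  by move=> i; apply: section_comb => // k; exact: msmooth_cst.
apply: filterS3 ot nU (cd _ (open_nbhs_nbhs (conj oN dn))) => x otx Ux' dx.
split; first exact: (orthonormal_act (exist _ D DD) otx).
apply/oh => //; rewrite -/(frame_mx h _) (frame_mx_act _ _ hU) //.
by rewrite det_mulmx det_tr dD mulN1r oppr_gt0.
Unshelve. all: by end_near. Qed.

End Frames.

(** * Lifts to isometries and to frame bundle automorphisms *)

Lemma sval_inj (T : Type) (P : T -> Prop) (u v : {x | P x}) :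
  sval u = sval v -> u = v.
Proof. by case: u v => x Px [y Py] /= xy; subst y; rewrite (Prop_irrelevance Px Py). Qed.

(** * Points of the frame bundles and transitivity of the structure groups *)

Section OrthonormalFrames.
Context {R : realType} {M : smooth_manifold R} {r : nat}.
Context {V : vector_bundle M r} {b : bundle_metric V}.

(** Reads the frame of [z] in the fibre over a prescribed [x], for points whose projection equals
    [x] only up to a proof, such as [Psi z] over [phi (OF_proj z)]. *)
Definition frame_at x (z : OF b) : 'I_r -> vfib V x :=
  fun i => fibre_pt x (vinc (OF_frame z i)).

Lemma frame_atE (z : OF b) : frame_at (OF_proj z) z = OF_frame z.
Proof. by apply/funext => i; exact: vincK. Qed.

Lemma OF_frame_orthonormal (z : OF b) : Defs.orthonormal b (OF_frame z).
Proof. exact: (svalP (projT2 z)). Qed.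

Lemma frame_at_orthonormal x (z : OF b) : OF_proj z = x ->
  Defs.orthonormal b (frame_at x z).
Proof. by move=> <-; rewrite frame_atE; exact: OF_frame_orthonormal. Qed.

Lemma frame_at_act x (z : OF b) A : OF_proj z = x ->
  frame_at x (OF_act z A) = frame_act (frame_at x z) (sval A).
Proof. by move=> <-; rewrite frame_atE; exact: (frame_atE (OF_act z A)). Qed.

Lemma OF_inc_inj : injective (@OF_inc _ _ _ _ b).
Proof.
move=> [x [e pe]] [y [f pf]]; rewrite /OF_inc /OF_proj /OF_frame /=.
move=> exy; have xy : x = y by case: exy.
subst y; congr existT; apply: sval_inj => /=; apply/funext => i.
by apply: vinc_inj; have := congr1 (fun p => p.2 i) exy.
Qed.

Lemma OF_incE x (z : OF b) : OF_proj z = x ->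
  OF_inc z = (x, fun i => vinc (frame_at x z i)).
Proof. by move=> <-; rewrite frame_atE. Qed.

Lemma OF_ext x (z z' : OF b) : OF_proj z = x -> OF_proj z' = x ->
  frame_at x z = frame_at x z' -> z = z'.
Proof.
by move=> zx zx' zz; apply: OF_inc_inj; rewrite (OF_incE zx) (OF_incE zx') zz.
Qed.

Lemma OF_transitive (z z' : OF b) : OF_proj z = OF_proj z' ->
  exists A : orthogonal_group, z' = OF_act z A.
Proof.
move=> zz; have oz := frame_at_orthonormal zz.
have oz' := frame_at_orthonormal (erefl (OF_proj z')).
exists (exist (fun A : 'M[R]_r => A^T *m A = 1%:M) _ (transition_orthogonal oz oz')).
apply: (@OF_ext (OF_proj z')) => //; rewrite frame_at_act //=.
exact: transitionP.
Qed.

Lemma frame_at_opos (o : orientation V) x (z : OpF b o) :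
  OpF_proj z = x -> opos o (frame_at x (sval z)).
Proof. by move=> <-; rewrite frame_atE; exact: (svalP z). Qed.

Lemma OpF_transitive (o : orientation V) (z z' : OpF b o) : OpF_proj z = OpF_proj z' ->
  exists A : special_orthogonal_group, z' = OpF_act z A.
Proof.
move=> zz; have [A zA] := OF_transitive zz.
have oz := frame_at_opos zz.
have := frame_at_opos (erefl (OpF_proj z')).
rewrite zA (frame_at_act _ zz) (opos_actP _ oz) => dA.
(* Orthogonality leaves 1 and -1; two positive frames exclude -1. *)
have dA1 : \det (sval A) = 1.
  have /eqP := congr1 (fun B => \det B) (svalP A).
  rewrite det_mulmx det_tr det1 -expr2 sqrf_eq1 => /orP[/eqP//|/eqP dN].
  by move: dA; rewrite dN oppr_gt0 ltr10.
by exists (exist _ A dA1); apply: sval_inj.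
Qed.

End OrthonormalFrames.

(** * From an automorphism of a frame bundle to an isometry *)

Section FromFrames.
Context {R : realType} {M : smooth_manifold R} {r : nat}.
Context {V : vector_bundle M r} {b : bundle_metric V}.
(* A principal bundle [P] of orthonormal frames: [OF b] itself or [OpF b o]. *)
Context {P G : Type} {emb : P -> OF b} {act : P -> G -> P} {mx : G -> 'M[R]_r}.
Let proj z := OF_proj (emb z).
Let inc z := OF_inc (emb z).
Context (frame_at_emb_act : forall z a x, proj z = x -> proj (act z a) = x /\
  frame_at x (emb (act z a)) = frame_act (frame_at x (emb z)) (mx a)).
Context (act_transitive : forall z z', proj z = proj z' -> exists a, z' = act z a).
Context (local_section : forall x0, exists t : 'I_r -> forall x, vfib V x,
  (forall i, msmooth (fun x => vinc (t i x)) x0) /\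
  \forall x \near x0, exists z, inc z = (x, fun i => vinc (t i x))).

Lemma frame_exists x : exists z, proj z = x.
Proof.
have [t [_ /nbhs_singleton[z]]] := local_section x.
by move=> [zx _]; exists z.
Qed.

(** [z0] is an arbitrary choice of a frame over each point, with no continuity. Smoothness is
    recovered in [frame_lift], where independence of the frame allows a smooth local one instead. *)
Definition frame_map (phi : M -> M) (Psi : P -> P) (z0 : M -> P) x
    (v : vfib V x) : vfib V (phi x) :=
  \sum_i ip b v (frame_at x (emb (z0 x)) i) *: frame_at (phi x) (emb (Psi (z0 x))) i.

Lemma frame_map_linear phi Psi z0 x : linear (@frame_map phi Psi z0 x).
Proof.
move=> a u v; rewrite /frame_map scaler_sumr -big_split /=.
by apply: eq_bigr => i _; rewrite ip_linear scalerDl scalerA.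
Qed.

Lemma frame_lift (phi : M -> M) (Psi : P -> P) : smooth phi ->
  (forall z, proj (Psi z) = phi (proj z)) ->
  (forall z a, Psi (act z a) = act (Psi z) a) ->
  @smooth_sub _ _ _ _ _ P P inc inc Psi ->
  exists Phix : forall x, {linear vfib V x -> vfib V (phi x)},
    (forall z x, proj z = x -> forall i,
      Phix x (frame_at x (emb z) i) = frame_at (phi x) (emb (Psi z)) i) /\
    smooth (fun v : V => vinc (Phix (vproj v) (fibre_pt (vproj v) v))).
Proof.
move=> sphi Psi_proj Psi_act Psi_smooth.
have /choice[z0 z0P] := frame_exists.
pose LM x := GRing.isLinear.Build _ _ _ _ _ (@frame_map_linear phi Psi z0 x).
pose L x : {linear vfib V x -> vfib V (phi x)} :=
  HB.pack (@frame_map phi Psi z0 x) (LM x).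
have LP z x : proj z = x -> forall i,
    L x (frame_at x (emb z) i) = frame_at (phi x) (emb (Psi z)) i.
  move=> zx i; have [|a za] := @act_transitive (z0 x) z; first by rewrite z0P.
  have [_ eq1] := frame_at_emb_act a (z0P x).
  have pz0 : proj (Psi (z0 x)) = phi x by rewrite Psi_proj z0P.
  have [_ eq2] := frame_at_emb_act a pz0.
  rewrite za Psi_act eq1 eq2 /frame_act linear_sum; apply: eq_bigr => k _.
  rewrite linearZ; congr (_ *: _); rewrite /= /frame_map (bigD1 k) //=.
  have ok := frame_at_orthonormal (z0P x).
  rewrite ok eqxx scale1r big1 ?addr0 // => l lk.
  by rewrite ok eq_sym (negPf lk) scale0r.
exists L; split=> //; apply/(smoothP _ (manifold_ok V) (manifold_ok V)) => v0.
set x0 := vproj v0.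
have [t [st tz]] := local_section x0.
have [z1 z1E] := nbhs_singleton tz.
have [W [g [oW Wz1 sg gE]]] := Psi_smooth z1.
(* [g] extends [Psi] to an open set of the ambient space, so [g \o S] is smooth near [x0] and sends
   [x] to the image under [Psi] of the frame [t] at [x]. *)
pose S x : prod_charted M (pow_charted r V) := (x, fun i => vinc (t i x)).
have okQ : charted_ok (prod_charted M (pow_charted r V)).
  by apply: prod_ok; [|apply: pow_ok]; exact: manifold_ok.
have fQ : findim ('rV[R]_(mdim M) * 'M[R]_(r, mdim V))%type.
  by apply: findim_prod; exact: findim_mx.
have sS : msmooth S x0.
  apply: msmooth_pair; first exact/msmooth_id/manifold_atlas.
  exact: msmooth_tuple.
have WS : W (S x0) by rewrite -[S x0]z1E.
have sgS : msmooth (g \o S) x0.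
  apply: (msmooth_comp (manifold_ok M) okQ fQ sS).
  exact: (smooth_onP g okQ okQ oW).1.
pose w i x : V := (g (S x)).2 i.
have sw i : msmooth (w i) x0.
  have s2 := msmooth_comp (manifold_ok M) okQ fQ sgS
    (msmooth_snd _ (pow_atlas r (manifold_atlas V)) (findim_mx _ _)).
  exact: (msmooth_comp (manifold_ok M) (pow_ok r (manifold_ok V)) (findim_mx _ _) s2
    (msmooth_proj i _ (manifold_atlas V))).
have nW : \forall x \near x0, W (S x).
  exact: (msmooth_continuous sS (open_nbhs_nbhs (conj oW WS))).
have tw : \forall x \near x0, exists z, [/\ proj z = x,
    forall i, frame_at x (emb z) i = t i x &
    forall i, w i x = vinc (frame_at (phi x) (emb (Psi z)) i)].
  apply: filterS2 nW tz => x Wx [z zE]; exists z.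
  have zx : proj z = x by case: zE.
  split=> // i.
    apply: vinc_inj; have := OF_incE zx; rewrite -/(inc z) zE => -[] e.
    by have := congr1 (fun f => f i) e.
  rewrite /w /S -zE gE ?zE // /inc (@OF_incE _ _ _ _ _ (phi x)) //.
  by rewrite -/(proj (Psi z)) Psi_proj zx.
have {}tw : \forall v \near v0, exists z, [/\ proj z = vproj v,
    forall i, frame_at (vproj v) (emb z) i = t i (vproj v) &
    forall i, w i (vproj v) = vinc (frame_at (phi (vproj v)) (emb (Psi z)) i)].
  exact: (msmooth_continuous (vproj_msmooth v0) tw).
have sp := vproj_msmooth v0.
have sphip : msmooth (phi \o @vproj _ _ _ V) v0.
  apply: (msmooth_comp (manifold_ok V) (manifold_ok M) (findim_mx _ _) sp).
  exact: (smoothP _ (manifold_ok M) (manifold_ok M)).1.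
(* Near [v0] the map is the combination of the smooth vectors [w i] with these coefficients, the
   coordinates of [v] in the frame [t]. *)
pose a i (v : V) : R := ip b (fibre_pt (vproj v) v)
  (fibre_pt (vproj v) (vinc (t i (vproj v)))).
have sa i : @msmooth _ _ _ V (model_charted R^o) (a i) v0.
  apply: (msmooth_ip (manifold_ok V)).
  - exact/msmooth_id/manifold_atlas.
  - exact: (msmooth_comp (manifold_ok V) (manifold_ok M) (findim_mx _ _) sp (st i)).
  - by near=> v.
  - by near=> v; rewrite vproj_vinc.
have swp i : msmooth (w i \o @vproj _ _ _ V) v0.
  exact: (msmooth_comp (manifold_ok V) (manifold_ok M) (findim_mx _ _) sp (sw i)).
have pw : \forall v \near v0, forall i, vproj ((w i \o @vproj _ _ _ V) v) = (phi \o @vproj _ _ _ V) v.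
  by apply: filterS tw => v [z [_ _ wE]] i; rewrite /= wE vproj_vinc.
apply: msmooth_ext (msmooth_comb (manifold_ok V) sphip sa swp pw).
  exact: manifold_ok.
apply: filterS tw => v [z [zv tE wE]]; congr (vinc _).
rewrite [in RHS](orthonormal_span (fibre_pt (vproj v) v) (frame_at_orthonormal zv)).
rewrite linear_sum; apply: eq_bigr => i _.
by rewrite linearZ LP // /a vincK tE /= wE vincK.
Unshelve. all: by end_near. Qed.

Lemma frame_lift_cancel (phi phi' : M -> M) (Psi Psi' : P -> P)
    (L : forall x, {linear vfib V x -> vfib V (phi x)})
    (L' : forall x, {linear vfib V x -> vfib V (phi' x)}) :
  cancel phi phi' -> cancel Psi Psi' ->
  (forall z, proj (Psi z) = phi (proj z)) ->
  (forall z x, proj z = x -> forall i,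
    L x (frame_at x (emb z) i) = frame_at (phi x) (emb (Psi z)) i) ->
  (forall z x, proj z = x -> forall i,
    L' x (frame_at x (emb z) i) = frame_at (phi' x) (emb (Psi' z)) i) ->
  cancel (fun v : V => vinc (L (vproj v) (fibre_pt (vproj v) v)))
         (fun v : V => vinc (L' (vproj v) (fibre_pt (vproj v) v))).
Proof.
move=> phiK PK Pproj LP LP' v; rewrite vproj_vinc vincK.
have [z zv] := frame_exists (vproj v).
have Pz : proj (Psi z) = phi (vproj v) by rewrite Pproj zv.
rewrite -[RHS](fibre_ptK (erefl (vproj v))).
rewrite (orthonormal_span (fibre_pt (vproj v) v) (frame_at_orthonormal zv)).
rewrite !linear_sum.
(* The base point [phi' (phi (vproj v))] occurs in the types of [L']. Once both linear maps are
   evaluated it is a mere argument of [frame_at], and [phiK] rewrites it without a type clash. *)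
under eq_bigr do rewrite linearZ LP // linearZ LP' // PK.
by rewrite phiK.
Qed.

(** The last clause, the effect of [Phix] on frames, is kept for the oriented case, where it decides
    orientations. *)
Lemma frame_automorphism_isometry (phi : M -> M) (Psi Psi' : P -> P) :
  diffeo phi -> cancel Psi Psi' -> cancel Psi' Psi ->
  @smooth_sub _ _ _ _ _ P P inc inc Psi -> @smooth_sub _ _ _ _ _ P P inc inc Psi' ->
  (forall z a, Psi (act z a) = act (Psi z) a) ->
  (forall z, proj (Psi z) = phi (proj z)) ->
  exists Phi Phix, @isometry_lift _ _ _ _ b phi Phi Phix /\
    (forall z x, proj z = x -> forall i,
      Phix x (frame_at x (emb z) i) = frame_at (phi x) (emb (Psi z)) i).
Proof.
move=> [sphi [_ [phi' [sphi' _ phiK0 phiK'0]]]] PK PK' sP sP' Pact Pproj.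
have phiK x : phi' (phi x) = x by exact: phiK0.
have phiK' x : phi (phi' x) = x by exact: phiK'0.
have Pact' z a : Psi' (act z a) = act (Psi' z) a.
  by rewrite -[in LHS](PK' z) -Pact PK.
have Pproj' z : proj (Psi' z) = phi' (proj z).
  by rewrite -[in RHS](PK' z) Pproj phiK.
have [L [LP sL]] := frame_lift sphi Pproj Pact sP.
have [L' [LP' sL']] := frame_lift sphi' Pproj' Pact' sP'.
have LE x (v : vfib V x) z : proj z = x ->
    L x v = \sum_i ip b v (frame_at x (emb z) i) *: frame_at (phi x) (emb (Psi z)) i.
  move=> zx; rewrite [in LHS](orthonormal_span v (frame_at_orthonormal zx)).
  by rewrite linear_sum; apply: eq_bigr => i _; rewrite linearZ LP.
have okP z x : proj z = x -> proj (Psi z) = phi x by move=> <-.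
exists (fun v : V => vinc (L (vproj v) (fibre_pt (vproj v) v))), L; split=> //; split.
- split=> //; split=> //.
  exists (fun v : V => vinc (L' (vproj v) (fibre_pt (vproj v) v))); split=> //.
  + by move=> v _; exact: frame_lift_cancel phiK PK Pproj LP LP' v.
  + by move=> v _; exact: frame_lift_cancel phiK' PK' Pproj' LP' LP v.
- by move=> x v; rewrite vproj_vinc vincK.
- move=> x w; have [z zx] := frame_exists x.
  exists (\sum_i ip b w (frame_at (phi x) (emb (Psi z)) i) *: frame_at x (emb z) i).
  rewrite [RHS](orthonormal_span w (frame_at_orthonormal (okP _ _ zx))).
  by rewrite linear_sum; apply: eq_bigr => i _; rewrite linearZ LP.
- move=> x u v; have [z zx] := frame_exists x.
  rewrite (LE x u z zx) (LE x v z zx) ip_suml.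
  rewrite [in RHS](orthonormal_span u (frame_at_orthonormal zx)) ip_suml.
  apply: eq_bigr => i _; congr (_ * _).
  rewrite ip_sym (orthonormal_coord (fun i => ip b v (frame_at x (emb z) i)));
    last exact/frame_at_orthonormal/okP.
  by rewrite ip_sym.
Qed.

End FromFrames.

(** * The two bundles, and from isometries back to automorphisms *)

Section Equivalences.
Context {R : realType} {M : smooth_manifold R} {r : nat}.
Context {V : vector_bundle M r} {b : bundle_metric V}.

Lemma OF_local_section x0 : exists t : 'I_r -> forall x, vfib V x,
  (forall i, msmooth (fun x => vinc (t i x)) x0) /\
  \forall x \near x0, exists z : OF b, OF_inc z = (x, fun i => vinc (t i x)).
Proof.
have [t [st ot]] := local_orthonormal_frame b x0.
exists t; split=> //; apply: filterS ot => x otx.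
by exists (existT _ x (exist _ (t ^~ x) otx)).
Qed.

Lemma OpF_local_section (o : orientation V) x0 :
  exists t : 'I_r -> forall x, vfib V x,
  (forall i, msmooth (fun x => vinc (t i x)) x0) /\
  \forall x \near x0, exists z : OpF b o, OpF_inc z = (x, fun i => vinc (t i x)).
Proof.
have [t [st ot]] := local_oriented_orthonormal_frame b o x0.
exists t; split=> //; apply: filterS ot => x [otx ptx].
by exists (exist (fun z : OF b => opos o (OF_frame z))
  (existT _ x (exist _ (t ^~ x) otx)) ptx).
Qed.

Lemma OF_automorphism_isometry phi : diffeo phi ->
  lifts_to_OF_automorphism b phi -> lifts_to_isometry b phi.
Proof.
move=> dphi [Psi [Psi' [[PK PK'] [sP sP'] Pact Pproj]]].
have [|||Phi [Phix [iso _]]] := @frame_automorphism_isometry _ _ _ _ b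
    _ _ id (@OF_act _ _ _ _ b) sval _ _ _ phi Psi Psi' dphi PK PK' sP sP' Pact Pproj.
- by move=> z A x zx; split=> //; exact: frame_at_act.
- exact: OF_transitive.
- exact: OF_local_section.
by exists Phi, Phix.
Qed.

Lemma OpF_automorphism_isometry (o : orientation V) phi : diffeo phi ->
  lifts_to_OpF_automorphism b o phi -> lifts_to_oriented_isometry b o phi.
Proof.
move=> dphi [Psi [Psi' [[PK PK'] [sP sP'] Pact Pproj]]].
have [|||Phi [Phix [iso LP]]] := @frame_automorphism_isometry _ _ _ _ b
    _ _ sval (@OpF_act _ _ _ _ b o) (fun A => sval (sval A)) _ _ _ phi Psi Psi'
    dphi PK PK' sP sP' Pact Pproj.
- by move=> z A x zx; split=> //; exact: frame_at_act.
- exact: OpF_transitive.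
- exact: OpF_local_section.
exists Phi, Phix; split=> // x e pe.
have [z zx] : exists z : OpF b o, OpF_proj z = x.
  by have [t [_ /nbhs_singleton[z [zx _]]]] := OpF_local_section o x; exists z.
have oz := frame_at_orthonormal zx; have pz := frame_at_opos zx.
(* [e] is the positive frame of [z] acted on by a matrix of positive determinant; its image is the
   frame of [Psi z], again positive, acted on by the same matrix. *)
move: pe; rewrite (transitionP e oz) (opos_actP _ pz) => dA.
have Pzx : OpF_proj (Psi z) = phi x by rewrite Pproj zx.
have -> : (fun i => Phix x (frame_act (frame_at x (sval z))
    (transition b (frame_at x (sval z)) e) i)) =
    frame_act (frame_at (phi x) (sval (Psi z))) (transition b (frame_at x (sval z)) e).
  apply/funext => i; rewrite linear_sum; apply: eq_bigr => k _.
  by rewrite linearZ LP.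
exact/opos_actP/dA/frame_at_opos.
Qed.

Definition OF_map (phi : M -> M) (Phi : V -> V)
    (p : prod_charted M (pow_charted r V)) : prod_charted M (pow_charted r V) :=
  (phi p.1, fun i => Phi (p.2 i)).

Lemma OF_map_smooth phi Phi : smooth phi -> smooth Phi ->
  smooth (OF_map phi Phi).
Proof.
move=> sphi sPhi.
have okQ : charted_ok (prod_charted M (pow_charted r V)).
  by apply: prod_ok; [|apply: pow_ok]; exact: manifold_ok.
have aV := manifold_atlas V.
apply/(smoothP _ okQ okQ) => p; apply: msmooth_pair.
  apply: (msmooth_comp okQ (manifold_ok M) (findim_mx _ _)
    (msmooth_fst _ (manifold_atlas M) (findim_mx _ _))).
  exact: (smoothP _ (manifold_ok M) (manifold_ok M)).1.
apply: msmooth_tuple => i.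
have s2 := msmooth_comp okQ (pow_ok r (manifold_ok V)) (findim_mx _ _)
  (msmooth_snd p (pow_atlas r aV) (findim_mx _ _)) (msmooth_proj i _ aV).
apply: (msmooth_comp okQ (manifold_ok V) (findim_mx _ _) s2).
exact: (smoothP _ (manifold_ok V) (manifold_ok V)).1.
Qed.

Lemma smooth_sub_restrict E F (X : charted E) (Y : charted F) (P Q : Type)
    (i : P -> X) (j : Q -> Y) (f : P -> Q) (g : X -> Y) : smooth g ->
  (forall z, j (f z) = g (i z)) -> @smooth_sub R _ _ X Y P Q i j f.
Proof.
move=> sg e z; exists setT, g; split=> //; first exact: openT.
Qed.

(** [Psi] and [Psi'] are chosen through equations between embedded points. Smoothness is then a
    restriction of [OF_map], and the cancellation laws follow from injectivity of [OF_inc]. *)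
Lemma isometry_OF_automorphism (phi : M -> M) Phi Phix : diffeo phi ->
  @isometry_lift _ _ _ _ b phi Phi Phix ->
  exists Psi Psi' : OF b -> OF b,
    [/\ cancel Psi Psi' /\ cancel Psi' Psi,
        @smooth_sub R _ _ _ _ _ _ (@OF_inc _ _ _ _ b) (@OF_inc _ _ _ _ b) Psi /\
        @smooth_sub R _ _ _ _ _ _ (@OF_inc _ _ _ _ b) (@OF_inc _ _ _ _ b) Psi',
        forall z a, Psi (OF_act z a) = OF_act (Psi z) a,
        forall z, OF_proj (Psi z) = phi (OF_proj z) &
        forall z, frame_at (phi (OF_proj z)) (Psi z) =
          (fun i => Phix (OF_proj z) (OF_frame z i))].
Proof.
move=> [sphi [_ [phi' [sphi' _ phiK phiK']]]].
move=> [[sPhi [_ [Phi' [sPhi' _ PhiK PhiK']]]] PhiE Phi_surj Phi_ip].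
have Psi_ex (z : OF b) : exists w : OF b, OF_inc w = OF_map phi Phi (OF_inc z).
  have ow : Defs.orthonormal b (fun i => Phix (OF_proj z) (OF_frame z i)).
    by move=> i j; rewrite Phi_ip; exact: (OF_frame_orthonormal z i j).
  exists (existT _ (phi (OF_proj z)) (exist _ _ ow)).
  by congr (_, _); apply/funext => i; rewrite PhiE.
have Psi_ex' (z : OF b) : exists w : OF b, OF_inc w = OF_map phi' Phi' (OF_inc z).
  have zx : OF_proj z = phi (phi' (OF_proj z)) by rewrite phiK'.
  (* The inverse is only known on total spaces; fibrewise surjectivity supplies preimages of the
     frame vectors, and these are orthonormal because [Phix] preserves the metric. *)
  have /choice[u uP] i := Phi_surj _ (frame_at (phi (phi' (OF_proj z))) z i).
  have ow : Defs.orthonormal b u.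
    by move=> i j; rewrite -Phi_ip !uP; exact: (frame_at_orthonormal zx i j).
  exists (existT _ (phi' (OF_proj z)) (exist _ _ ow)).
  congr (_, _); apply/funext => i.
  change (vinc (u i) = Phi' (vinc (OF_frame z i))).
  by rewrite -[LHS]PhiK // PhiE uP fibre_ptK // vproj_vinc.
have /choice[Psi PsiE] := Psi_ex; have /choice[Psi' PsiE'] := Psi_ex'.
have Pproj z : OF_proj (Psi z) = phi (OF_proj z) by case: (PsiE z).
have Pfr z : frame_at (phi (OF_proj z)) (Psi z) =
    (fun i => Phix (OF_proj z) (OF_frame z i)).
  apply/funext => i; apply: vinc_inj; rewrite -PhiE.
  have := PsiE z; rewrite (OF_incE (Pproj z)) => -[] e.
  by have := congr1 (fun f => f i) e.
exists Psi, Psi'; split=> //.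
- split=> z; apply: OF_inc_inj.
    rewrite PsiE' PsiE /OF_map /= phiK //; congr (_, _).
    by apply/funext => i; rewrite PhiK.
  rewrite PsiE PsiE' /OF_map /= phiK' //; congr (_, _).
  by apply/funext => i; rewrite PhiK'.
- by split; [apply: smooth_sub_restrict (OF_map_smooth sphi sPhi) _|
             apply: smooth_sub_restrict (OF_map_smooth sphi' sPhi') _].
- move=> z a; apply: (@OF_ext _ _ _ _ _ (phi (OF_proj z))).
  + exact: Pproj.
  + exact: Pproj.
  rewrite (frame_at_act _ (Pproj z)) Pfr (Pfr (OF_act z a)).
  by apply/funext => i; rewrite linear_sum; apply: eq_bigr => k _; rewrite linearZ.
Qed.

Lemma isometry_OpF_automorphism (o : orientation V) phi : diffeo phi ->
  lifts_to_oriented_isometry b o phi -> lifts_to_OpF_automorphism b o phi.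
Proof.
move=> dphi [Phi [Phix [iso pos]]].
have [Psi [Psi' [[PK PK'] [sP sP'] Pact Pproj Pfr]]] :=
  isometry_OF_automorphism dphi iso.
(* [pos] gives one implication only. For the converse, needed by [Psi'], [z] is compared with a
   positive frame [w]: positivity of [z] and of [Psi z] is the sign of one and the same transition
   determinant. *)
have Ppos (z : OF b) : opos o (OF_frame (Psi z)) <-> opos o (OF_frame z).
  have [w wx] : exists w : OpF b o, OpF_proj w = OF_proj z.
    have [t [_ /nbhs_singleton[w [wx _]]]] := OpF_local_section o (OF_proj z).
    by exists w.
  have ow := frame_at_orthonormal wx; have pw := frame_at_opos wx.
  rewrite -[OF_frame z]frame_atE -[OF_frame (Psi z)]frame_atE Pproj Pfr -frame_atE.
  rewrite (transitionP (frame_at (OF_proj z) z) ow) (opos_actP _ pw).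
  have pPw := pos _ _ pw.
  rewrite -(opos_actP _ pPw).
  suff -> : (fun i => Phix (OF_proj z) (frame_act (frame_at (OF_proj z) (sval w))
      (transition b (frame_at (OF_proj z) (sval w)) (frame_at (OF_proj z) z)) i)) =
      frame_act (fun i => Phix (OF_proj z) (frame_at (OF_proj z) (sval w) i))
      (transition b (frame_at (OF_proj z) (sval w)) (frame_at (OF_proj z) z)) by [].
  by apply/funext => i; rewrite linear_sum; apply: eq_bigr => k _; rewrite linearZ.
pose Q (z : OpF b o) : OpF b o := exist (fun z : OF b => opos o (OF_frame z))
  (Psi (sval z)) ((Ppos _).2 (svalP z)).
have Ppos' (z : OpF b o) : opos o (OF_frame (Psi' (sval z))).
  by apply/Ppos; rewrite PK'; exact: (svalP z).
pose Q' (z : OpF b o) : OpF b o := exist (fun z : OF b => opos o (OF_frame z))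
  (Psi' (sval z)) (Ppos' z).
exists Q, Q'; split.
- by split=> z; apply: sval_inj; [exact: PK|exact: PK'].
- split=> z.
    have [W [g [oW Wz sg gE]]] := sP (sval z).
    by exists W, g; split=> // z'; exact: gE.
  have [W [g [oW Wz sg gE]]] := sP' (sval z).
  by exists W, g; split=> // z'; exact: gE.
- by move=> z a; apply: sval_inj; exact: Pact.
- by move=> z; exact: Pproj.
Qed.

End Equivalences.

Theorem proposition14 (R : realType) (M : smooth_manifold R) (r : nat)
    (V : vector_bundle M r) (b : bundle_metric V)
    (phi : M -> M) (phi_diffeo : diffeo phi) :
  (lifts_to_isometry b phi <-> lifts_to_OF_automorphism b phi) /\
  (forall o : orientation V,
     lifts_to_oriented_isometry b o phi <-> lifts_to_OpF_automorphism b o phi).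
Proof.
split=> [|o]; split.
- move=> [Phi [Phix /(isometry_OF_automorphism phi_diffeo)]].
  by move=> [Psi [Psi' [c s a p _]]]; exists Psi, Psi'.
- exact: OF_automorphism_isometry.
- exact: isometry_OpF_automorphism.
- exact: OpF_automorphism_isometry.
Qed.
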